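(* Let $P(\rho)=K\rho^\gamma$ with $K>0$ and $\gamma>\frac43$. Let $\sigma$ be the minimizer of $E_0$ with mass $1$, and for $m>0$ let $\sigma_m(x)=\frac1A\,\sigma\!\left(\frac1B x\right)$ be the minimizer of $E_0$ with mass $m$, where $A=m^{-\frac{2}{3\gamma-4}}$ and $B=m^{\frac{\gamma-2}{3\gamma-4}}$. There are constants $C_1$ and $R_1$ such that $\|\sigma\|_{L^\infty(\mathbb{R}^3)}\le C_1$ and $\operatorname{spt}\sigma$ is contained in a ball of radius $R_1$. Therefore $$\|\sigma_m\|_{L^\infty(\mathbb{R}^3)}\le C_m=\frac{C_1}{A}\quad\text{and}\quad \operatorname{spt}\sigma_m\text{ is contained in a ball of radius }R_m=BR_1 .$$ If moreover $\gamma>2$, then $\lim_{m\to0}A=+\infty$ and $\lim_{m\to0}B=0$, so that $\|\sigma_m\|_{L^\infty(\mathbb{R}^3)}$ and the size of the support of $\sigma_m$ go to $0$ when $m\to0$, with rates $m^{\frac{2}{3\gamma-4}}$ and $m^{\frac{\gamma-2}{3\gamma-4}}$ respectively. Here $\|\sigma_m\|_{L^\infty(\mathbb{R}^3)}$ is actually the central density of $\sigma_m$, so this gives the decay rate of the central density and strengthens the statement that the mass $m$ can be viewed as a strictly increasing function of the minimizers' central density. However, when $\gamma<2$, $\lim_{m\to0}B=\infty$, and the size of the support of $\sigma_m$ can go to $\infty$ when $m\to0$ (the density flattens out or spreads). This coincides with a result of Lieb and Yau, in a quantum mechanical (fermion) setting, that the radius $R_m\to\infty$ as $m\to0$.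
   Context: For $m>0$, $mR(\mathbb{R}^3):=\{\rho\in L^{4/3}(\mathbb{R}^3): \rho\ge0,\ \int_{\mathbb{R}^3}\rho\,dx=m\}$. The energy (of a non-rotating star) is $E_0(\rho)=\int_{\mathbb{R}^3}\frac{K}{\gamma-1}\rho^\gamma\,dx-\frac12\iint_{\mathbb{R}^3\times\mathbb{R}^3}\frac{\rho(x)\rho(y)}{|x-y|}\,dx\,dy$, where $P$ is the pressure. ''The minimizer of $E_0$ with mass $m$'' means the minimizer of $E_0$ on $mR(\mathbb{R}^3)$, which exists and is unique up to translation; after translation it is continuous, spherically symmetric about $0$ and radially decreasing, and its central density is its value at $0$. $\operatorname{spt}\rho$ denotes the smallest closed set carrying the full mass of $\rho$. *)

(* Defs.v *)
From HB Require Import structures.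
From mathcomp Require Import all_boot all_order all_algebra.
From mathcomp Require Import all_classical all_reals all_analysis.

Set Implicit Arguments.
Unset Strict Implicit.
Unset Printing Implicit Defensive.

Import Order.TTheory GRing.Theory Num.Theory.
Import numFieldNormedType.Exports.

Local Open Scope classical_set_scope.
Local Open Scope ring_scope.

(* The factors are copies of R carrying the Borel sigma-algebra, as in the type
   of lebesgue_measure. The topology and the Borel sets of the product are the
   usual ones of R^3, but its canonical norm is the sup norm: the Euclidean norm
   is enorm below. *)
Notation R3 R := (measurableTypeR R * measurableTypeR R * measurableTypeR R)%type.

(* lebesgue2 exists only to declare the sigma-finite instances, which inference
   does not find on a bare product of sigma-finite measures. *)
Definition lebesgue2 (R : realType) :
    set (measurableTypeR R * measurableTypeR R)%type -> \bar R :=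
  (@lebesgue_measure R \x @lebesgue_measure R)%E.

HB.instance Definition _ (R : realType) := Measure.on (@lebesgue2 R).

Lemma lebesgue2_sigma_finite (R : realType) :
  sigma_finite [set: measurableTypeR R * measurableTypeR R] (@lebesgue2 R).
Proof.
have /sigma_finiteP[F [TF ndF Foo]] := sigma_finiteT (@lebesgue_measure R).
exists (fun n => F n `*` F n).
  rewrite -setXTT TF predeqE => -[x y]; split.
    move=> [/= [n _ Fnx] [k _ Fky]]; exists (maxn n k) => //; split.
    - by move: x Fnx; exact/subsetPset/ndF/leq_maxl.
    - by move: y Fky; exact/subsetPset/ndF/leq_maxr.
  by move=> [n _ []/= ? ?]; split; exists n.
move=> k; have [? ?] := Foo k; split; first exact: measurableX.
by rewrite [X in (X < _)%E]product_measure1E// lte_mul_pinfty// ge0_fin_numE.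
Qed.

HB.instance Definition _ (R : realType) :=
  Measure_isSigmaFinite.Build _ _ _ (@lebesgue2 R) (@lebesgue2_sigma_finite R).

Definition lebesgue3 (R : realType) : set (R3 R) -> \bar R :=
  (@lebesgue2 R \x @lebesgue_measure R)%E.

HB.instance Definition _ (R : realType) := Measure.on (@lebesgue3 R).

Lemma lebesgue3_sigma_finite (R : realType) :
  sigma_finite [set: R3 R] (@lebesgue3 R).
Proof.
have /sigma_finiteP[F [TF ndF Foo]] := sigma_finiteT (@lebesgue2 R).
have /sigma_finiteP[G [TG ndG Goo]] := sigma_finiteT (@lebesgue_measure R).
exists (fun n => F n `*` G n).
  rewrite -setXTT TF TG predeqE => -[x y]; split.
    move=> [/= [n _ Fnx] [k _ Gky]]; exists (maxn n k) => //; split.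
    - by move: x Fnx; exact/subsetPset/ndF/leq_maxl.
    - by move: y Gky; exact/subsetPset/ndG/leq_maxr.
  by move=> [n _ []/= ? ?]; split; exists n.
move=> k; have [? ?] := Foo k; have [? ?] := Goo k.
split; first exact: measurableX.
by rewrite [X in (X < _)%E]product_measure1E// lte_mul_pinfty// ge0_fin_numE.
Qed.

HB.instance Definition _ (R : realType) :=
  Measure_isSigmaFinite.Build _ _ _ (@lebesgue3 R) (@lebesgue3_sigma_finite R).

Definition enorm (R : realType) (x : R3 R) : R :=
  Num.sqrt (x.1.1 ^+ 2 + x.1.2 ^+ 2 + x.2 ^+ 2).

Definition eball (R : realType) (c : R3 R) (r : R) : set (R3 R) :=
  [set x | enorm (x - c) < r].

(* m R(R^3); elements of L^{4/3} are represented by functions that are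
   nonnegative everywhere. *)
Definition densities (R : realType) (m : R) : set (R3 R -> R) :=
  [set rho | [/\ rho \in Lfun (@lebesgue3 R) (4 / 3)%:E,
                 forall x, 0 <= rho x
               & (\int[@lebesgue3 R]_x (rho x)%:E = m%:E)%E]].

(* Energy for the pressure P(s) = K s^gamma. It takes its values in the extended
   reals because rho^gamma need not be integrable when rho is in L^1 and
   L^{4/3}; the double integral is finite on these densities by the
   Hardy-Littlewood-Sobolev inequality. On the (null) diagonal x = y, the
   quotient is 0 by the convention 0^-1 = 0. *)
Definition energy (R : realType) (K gamma : R) (rho : R3 R -> R) : \bar R :=
  (\int[@lebesgue3 R]_x (K / (gamma - 1) * rho x `^ gamma)%:E
   - (2^-1)%:E * \int[@lebesgue3 R \x @lebesgue3 R]_z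
                 (rho z.1 * rho z.2 / enorm (z.1 - z.2))%:E)%E.

Definition is_minimizer (R : realType) (K gamma m : R) (rho : R3 R -> R) :=
  densities m rho /\
  forall rho', densities m rho' -> (energy K gamma rho <= energy K gamma rho')%E.

(* "The minimizer of E_0 with mass m", normalized by translation so as to be
   continuous, spherically symmetric about 0 and radially decreasing. It has
   compact support, so "decreasing" is meant in the weak sense. *)
Record is_the_minimizer (R : realType) (K gamma m : R) (rho : R3 R -> R) : Prop := {
  the_minimizer_min : is_minimizer K gamma m rho ;
  the_minimizer_uniq : forall rho', is_minimizer K gamma m rho' ->
    exists a, {ae @lebesgue3 R, forall x, rho' x = rho (x - a)} ;
  the_minimizer_cont : continuous rho ;
  the_minimizer_sym : forall x y, enorm x = enorm y -> rho x = rho y ;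
  the_minimizer_decr : forall x y, enorm x <= enorm y -> rho y <= rho x }.

Definition spt (R : realType) (rho : R3 R -> R) : set (R3 R) :=
  \bigcap_(F in [set F : set (R3 R) | closed F /\
     (\int[@lebesgue3 R]_(x in F) (rho x)%:E = \int[@lebesgue3 R]_x (rho x)%:E)%E]) F.

Definition in_ball_of_radius (R : realType) (S : set (R3 R)) (r : R) :=
  exists c, S `<=` eball c r.

(* Size of a set: the infimum of the radii of the balls containing it. *)
Definition set_size (R : realType) (S : set (R3 R)) : \bar R :=
  ereal_inf [set r%:E | r in [set r : R | 0 <= r /\ in_ball_of_radius S r]].

Definition Linfty_norm (R : realType) (rho : R3 R -> R) : \bar R :=
  ('N[@lebesgue3 R]_+oo[EFin \o rho])%E.

Definition scaleA (R : realType) (gamma m : R) : R :=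
  m `^ (- (2 / (3 * gamma - 4))).

Definition scaleB (R : realType) (gamma m : R) : R :=
  m `^ ((gamma - 2) / (3 * gamma - 4)).

Definition rescaled (R : realType) (gamma : R) (sigma : R3 R -> R) (m : R) :
    R3 R -> R :=
  fun x => (scaleA gamma m)^-1 * sigma ((scaleB gamma m)^-1 *: x).

(* Main.v *)
Require Import Defs.
From HB Require Import structures.
From mathcomp Require Import all_boot all_order all_algebra.
From mathcomp Require Import all_classical all_reals all_analysis.
From mathcomp Require Import measurable_realfun ess_sup_inf ring lra.

Set Implicit Arguments.
Unset Strict Implicit.
Unset Printing Implicit Defensive.

Import Order.TTheory GRing.Theory Num.Theory.
Import numFieldNormedType.Exports.

Local Open Scope classical_set_scope.
Local Open Scope ring_scope.

(** The proof has two sources: exact scaling, and a cutting argument for the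
compactness of the support.

Scaling. Write [a f(b x)] for the dilate of [f]. A linear change of variables
multiplies the mass by [a b^-3], the kinetic term by [a^gamma b^-3] and the
self-interaction by [a^2 b^-5]. For [a = A^-1] and [b = B^-1] the first factor
is [m] and the other two are both [m^p] with [p = (5 gamma - 6)/(3 gamma - 4)],
so rescaling maps the densities of mass [M] onto those of mass [m M] and
multiplies all the energies by one positive constant: it preserves minimizers,
together with their uniqueness, continuity and monotonicity
([is_the_minimizer_rescaled]). The support of a continuous density is the
closure of its positivity set ([sptE]), hence is dilated by [B]; the sup norm of
a continuous density that decreases radially is its value at [0]
([Linfty_norm_max]), hence is divided by [A]. The limits and rates are then
those of powers of [m], with positive finite coefficients [sigma 0] and the size
of the support of [sigma]. Two normalized minimizers of the same mass have the
same central density ([the_minimizer_center]), so the central density is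
[sigma 0 * m^(2/(3 gamma - 4))] and can be inverted.

Compact support ([compact_support]). First, the energy of [sigma] is [- e] with
[e > 0]: the dilates [t^3 sigma(t x)] have mass [1] and energy
[t^(3 gamma - 3) T - t W / 2], which is negative for small [t] since
[3 gamma - 3 > 1] ([energy_lt0]). Next, the potential of [sigma] tends to [0] at
infinity ([potential_cvg0]), because [1/|z|] is locally integrable and [sigma]
decreases to [0]. Cut [sigma] at a radius beyond which its potential is at most
[e/2], and let [eps] be the mass of the tail. Removing the tail raises the
energy by at most [eps e / 2]. On the other hand the core has mass [1 - eps] and
rescaling it to mass [1] gives a competitor, so its energy is at least
[- (1 - eps)^p e], which is at least [- (1 - eps) e] because [p >= 1]. Hence
[eps e <= eps e / 2] and the tail is null. This replaces the usual study of the
Euler-Lagrange equation and of the sign of its multiplier. *)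

(** * Maps that scale a measure *)

(** [mu] is [k] times its image by [phi], in the integrated form that is used
below; products of measures are then handled by Tonelli's theorem. *)
Definition scales_measure d (T : measurableType d) (R : realType)
    (mu : {measure set T -> \bar R}) (phi : T -> T) (k : R) :=
  measurable_fun [set: T] phi /\
  forall f : T -> \bar R, measurable_fun [set: T] f -> (forall x, 0 <= f x)%E ->
    (\int[mu]_x f x = k%:E * \int[mu]_x f (phi x))%E.

Lemma scales_measure_prod d1 d2 (T1 : measurableType d1) (T2 : measurableType d2)
    (R : realType) (m1 : {sigma_finite_measure set T1 -> \bar R})
    (m2 : {sigma_finite_measure set T2 -> \bar R})
    (phi1 : T1 -> T1) (phi2 : T2 -> T2) (k1 k2 : R) : 0 <= k1 -> 0 <= k2 ->
  scales_measure m1 phi1 k1 -> scales_measure m2 phi2 k2 ->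
  scales_measure (m1 \x m2)%E (fun z => (phi1 z.1, phi2 z.2)) (k1 * k2).
Proof.
move=> k10 k20 [mphi1 H1] [mphi2 H2].
have mphi : measurable_fun setT (fun z : T1 * T2 => (phi1 z.1, phi2 z.2)).
  by apply: measurable_fun_pair; apply: measurableT_comp.
split => // f mf f0.
rewrite fubini_tonelli1// [in RHS](fubini_tonelli1 (fun z => f (phi1 z.1, phi2 z.2)))//;
  last exact: (measurableT_comp mf mphi).
rewrite EFinM -muleA /fubini_F /=.
have mF := @measurable_fun_fubini_tonelli_F _ _ _ _ R m2 f mf f0.
have F0 x : (0 <= fubini_F m2 f x)%E by apply: integral_ge0.
rewrite (H1 _ mF F0); congr (_ * _)%E.
rewrite -ge0_integralZl_EFin//; last 2 first.
- by move=> x _; apply: integral_ge0.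
- exact: (@measurable_fun_fubini_tonelli_F _ _ _ _ R m2
    (fun z => f (phi1 z.1, phi2 z.2)) (measurableT_comp mf mphi)).
apply: eq_integral => x _; rewrite /fubini_F (H2 (fun y => f (phi1 x, y)))//.
exact: measurable_fun_pair2.
Qed.

(** Lebesgue measure and [b] times its image by the affine map agree on the
half-open intervals, hence everywhere. *)
Lemma scales_measure_affine1 (R : realType) (b a : R) : 0 < b ->
  scales_measure (@lebesgue_measure R)
    (fun x : measurableTypeR R => b * x + a : measurableTypeR R) b.
Proof.
move=> b0; pose phi (x : measurableTypeR R) : measurableTypeR R := b * x + a.
have mphi : measurable_fun [set: measurableTypeR R] phi.
  apply: (@measurable_funD _ (measurableTypeR R) R setT (fun x => b * x) (cst a)) => //.
  by apply: (@measurable_funM _ (measurableTypeR R) R setT (cst b) id).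
split => // f mf f0.
pose nu0 : {measure set (measurableTypeR R) -> \bar R} :=
  measure_function_pushforward__canonical__measure_function_Measure
    (@lebesgue_measure R) mphi.
pose nu := mscale (NngNum (ltW b0)) nu0.
have nuE : forall A, measurable A -> lebesgue_measure A = nu A.
  apply: lebesgue_measure_unique => _ [[c d] /= cd <-].
  rewrite /nu /mscale /nu0 /= /pushforward.
  have -> : phi @^-1` `]c, d]%classic = `](c - a) / b, (d - a) / b]%classic.
    apply/seteqP; split => x /=; rewrite !in_itv/= /phi => /andP[cx xd]; apply/andP.
      by rewrite ltr_pdivrMr// ler_pdivlMr//; split; lra.
    by move: cx xd; rewrite ltr_pdivrMr// ler_pdivlMr//; split; lra.
  rewrite !lebesgue_measure_itv /=  !lte_fin ltr_pM2r ?invr_gt0// ltrD2r.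
  case: ifPn => _; last by rewrite mule0.
  by rewrite -!EFinB -EFinM; congr EFin; field; rewrite gt_eqF.
rewrite (@eq_measure_integral _ _ _ setT nu); last by move=> A mA _; exact: nuE.
by rewrite ge0_integral_mscale// ge0_integral_pushforward.
Qed.

Section affine.
Context {R : realType}.
Implicit Types (a x : R3 R) (b : R).

Lemma scales_measure_affine3 b a : 0 < b ->
  scales_measure (@lebesgue3 R) (fun x => b *: x + a) (b ^+ 3).
Proof.
move=> b0.
have s1 c := @scales_measure_affine1 R b c b0.
have s2 := @scales_measure_prod _ _ _ _ R (@lebesgue_measure R) (@lebesgue_measure R)
  _ _ _ _ (ltW b0) (ltW b0) (s1 a.1.1) (s1 a.1.2).
have s3 := @scales_measure_prod _ _ _ _ R (@lebesgue2 R) (@lebesgue_measure R)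
  _ _ _ _ (mulr_ge0 (ltW b0) (ltW b0)) (ltW b0) s2 (s1 a.2).
have -> : b ^+ 3 = b * b * b by ring.
exact: s3.
Qed.

Lemma scales_measure_dilation b : 0 < b ->
  scales_measure (@lebesgue3 R) (fun x => b *: x) (b ^+ 3).
Proof.
move=> b0; have := @scales_measure_affine3 b 0 b0.
by under [X in scales_measure _ X]eq_fun do rewrite addr0.
Qed.

Lemma scales_measure_dilation2 b : 0 < b ->
  scales_measure (@lebesgue3 R \x @lebesgue3 R)%E
    (fun z => (b *: z.1, b *: z.2)) (b ^+ 6).
Proof.
move=> b0; have b30 : 0 <= b ^+ 3 by rewrite exprn_ge0// ltW.
have := @scales_measure_prod _ _ _ _ R (@lebesgue3 R) (@lebesgue3 R)
  _ _ _ _ b30 b30 (scales_measure_dilation b0) (scales_measure_dilation b0).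
by rewrite -exprD.
Qed.

End affine.

(** * Euclidean norm and cubes *)

Section enorm.
Context {R : realType}.
Implicit Types (x y z c : R3 R) (b r : R).

Lemma enorm_ge0 x : 0 <= enorm x. Proof. exact: sqrtr_ge0. Qed.

Lemma enorm_sqr x : enorm x ^+ 2 = x.1.1 ^+ 2 + x.1.2 ^+ 2 + x.2 ^+ 2.
Proof. by rewrite sqr_sqrtr// !addr_ge0// sqr_ge0. Qed.

Lemma enorm_leP x r : 0 <= r ->
  (enorm x <= r) = (x.1.1 ^+ 2 + x.1.2 ^+ 2 + x.2 ^+ 2 <= r ^+ 2).
Proof. by move=> r0; rewrite -enorm_sqr ler_sqr// nnegrE// enorm_ge0. Qed.

Lemma enormZ b x : 0 <= b -> enorm (b *: x) = b * enorm x.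
Proof.
move=> b0; rewrite -{2}(ger0_norm b0) -sqrtr_sqr -sqrtrM ?sqr_ge0//.
congr Num.sqrt => /=; rewrite /GRing.scale /=; ring.
Qed.

Lemma enormN x : enorm (- x) = enorm x.
Proof. by congr Num.sqrt => /=; rewrite !sqrrN. Qed.

Lemma enorm_distC x y : enorm (x - y) = enorm (y - x).
Proof. by rewrite -enormN opprB. Qed.

Lemma enorm0 : enorm (0 : R3 R) = 0.
Proof. by rewrite /enorm /= expr0n /= !addr0 sqrtr0. Qed.

Lemma enorm_triangle x y : enorm (x + y) <= enorm x + enorm y.
Proof.
rewrite enorm_leP ?addr_ge0 ?enorm_ge0//=.
(* the Cauchy-Schwarz inequality, from the Lagrange identity *)
suff : x.1.1 * y.1.1 + x.1.2 * y.1.2 + x.2 * y.2 <= enorm x * enorm y.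
  by have := enorm_sqr x; have := enorm_sqr y; nra.
apply: (le_trans (ler_norm _)).
rewrite -ler_sqr ?nnegrE ?mulr_ge0 ?enorm_ge0// real_normK ?num_real//.
rewrite exprMn !enorm_sqr.
have := sqr_ge0 (x.1.1 * y.1.2 - x.1.2 * y.1.1).
have := sqr_ge0 (x.1.1 * y.2 - x.2 * y.1.1).
have := sqr_ge0 (x.1.2 * y.2 - x.2 * y.1.2).
nra.
Qed.

Lemma coord_le_enorm x :
  [/\ `|x.1.1| <= enorm x, `|x.1.2| <= enorm x & `|x.2| <= enorm x].
Proof.
have := sqr_ge0 x.1.1; have := sqr_ge0 x.1.2; have := sqr_ge0 x.2.
by split; rewrite -ler_sqr ?nnegrE ?enorm_ge0// real_normK ?num_real// enorm_sqr; nra.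
Qed.

Lemma enorm_le_coord x r : `|x.1.1| <= r -> `|x.1.2| <= r -> `|x.2| <= r ->
  enorm x <= 2 * r.
Proof.
move=> h1 h2 h3; have r0 : 0 <= r by exact: le_trans h1.
rewrite enorm_leP ?mulr_ge0//.
move: h1 h2 h3; rewrite -!(@ler_sqr _ `|_|) ?nnegrE// !real_normK ?num_real//.
nra.
Qed.

Lemma continuous_enorm : continuous (@enorm R : R3 R -> R).
Proof.
move=> x; apply: (@continuous_comp _ _ _
  (fun x : R3 R => x.1.1 ^+ 2 + x.1.2 ^+ 2 + x.2 ^+ 2 : R) Num.sqrt);
  last exact: sqrt_continuous.
have c1 : {for x, continuous (fun x : R3 R => x.1 : R * R)} by exact: cvg_fst.
have c2 : {for x, continuous (fun x : R3 R => x.2 : R)} by exact: cvg_snd.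
have c11 : {for x, continuous (fun x : R3 R => x.1.1 : R)}.
  by apply: (continuous_comp c1); exact: cvg_fst.
have c12 : {for x, continuous (fun x : R3 R => x.1.2 : R)}.
  by apply: (continuous_comp c1); exact: cvg_snd.
apply: (@continuousD R R); first apply: (@continuousD R R).
all: by apply: (continuous_comp _ (@exprn_continuous R 2 _)).
Qed.

Lemma measurable_enorm : measurable_fun [set: R3 R] (@enorm R).
Proof.
apply: (measurableT_comp (continuous_measurable_fun (@sqrt_continuous R))).
have c1 : measurable_fun [set: R3 R] (fun x => x.1.1 : R).
  exact: (measurableT_comp (@measurable_fst _ _ _ _) (@measurable_fst _ _ _ _)).
have c2 : measurable_fun [set: R3 R] (fun x => x.1.2 : R).
  exact: (measurableT_comp (@measurable_snd _ _ _ _) (@measurable_fst _ _ _ _)).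
have c3 : measurable_fun [set: R3 R] (fun x => x.2 : R).
  exact: (@measurable_snd _ _ _ _).
by apply: measurable_funD; first apply: measurable_funD; exact: measurable_funX.
Qed.

Lemma measurable_enorm_lt r : measurable [set x : R3 R | enorm x < r].
Proof.
have -> : [set x : R3 R | enorm x < r] =
    [set: R3 R] `&` (@enorm R) @^-1` `]-oo, r[%classic.
  by apply/seteqP; split => x /=; rewrite in_itv/= => //; case.
by apply: measurable_enorm => //; exact: measurable_itv.
Qed.

Lemma measurable_invenorm : measurable_fun [set: R3 R] (fun x => (enorm x)^-1).
Proof.
under eq_fun do rewrite -powR_inv1 ?enorm_ge0//.
exact: (measurableT_comp (measurable_powR (-1)) measurable_enorm).
Qed.

Lemma measurable_subR3 : measurable_fun [set: R3 R * R3 R]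
  (fun z : R3 R * R3 R => z.1 - z.2 : R3 R).
Proof.
have m (f : R3 R -> R) : measurable_fun [set: R3 R] f ->
    measurable_fun [set: R3 R * R3 R] (fun z : R3 R * R3 R => f z.1 - f z.2).
  move=> mf; apply: measurable_funB.
    exact: (measurableT_comp mf (@measurable_fst _ _ _ _)).
  exact: (measurableT_comp mf (@measurable_snd _ _ _ _)).
have m1 := m (fun x => x.1.1 : R)
  (measurableT_comp (@measurable_fst _ _ _ _) (@measurable_fst _ _ _ _)).
have m2 := m (fun x => x.1.2 : R)
  (measurableT_comp (@measurable_snd _ _ _ _) (@measurable_fst _ _ _ _)).
have m3 := m (fun x => x.2 : R) (@measurable_snd _ _ _ _).
by apply: measurable_fun_pair => //; apply: measurable_fun_pair.
Qed.

Lemma measurable_invdist :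
  measurable_fun [set: R3 R * R3 R] (fun z : R3 R * R3 R => (enorm (z.1 - z.2))^-1).
Proof. exact: (measurableT_comp measurable_invenorm measurable_subR3). Qed.

(** Cubes play the part of balls: their measure is explicit and they form a
basis of neighbourhoods. *)
Definition cube c r : set (R3 R) :=
  (`]c.1.1 - r, c.1.1 + r[%classic `*` `]c.1.2 - r, c.1.2 + r[%classic)
    `*` `]c.2 - r, c.2 + r[%classic.

Lemma cubeP c r x : cube c r x <->
  [/\ `|x.1.1 - c.1.1| < r, `|x.1.2 - c.1.2| < r & `|x.2 - c.2| < r].
Proof.
rewrite /cube /= !in_itv /= !ltr_distl; split=> [[[-> ->] ->//]|[-> -> ->//]].
Qed.

Lemma measurable_cube c r : measurable (cube c r).
Proof. by apply: measurableX; [apply: measurableX|]; exact: measurable_itv. Qed.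

Lemma lebesgue3_cube c r : 0 < r -> @lebesgue3 R (cube c r) = ((2 * r) ^+ 3)%:E.
Proof.
move=> r0; have l a : @lebesgue_measure R `]a - r, a + r[%classic = (2 * r)%:E.
  rewrite lebesgue_measure_itv /= lte_fin ifT; last by lra.
  by rewrite -EFinB; congr EFin; lra.
have ma (a : R) : measurable (`]a - r, a + r[%classic : set (measurableTypeR R)).
  exact: measurable_itv.
rewrite /lebesgue3 product_measure1E//; last exact: measurableX.
rewrite /= /lebesgue2 product_measure1E//= !l -!EFinM.
by congr EFin; ring.
Qed.

Lemma nbhs_cube x (U : set (R3 R)) : nbhs x U -> exists2 r, 0 < r & cube x r `<=` U.
Proof.
move=> /nbhs_ballP[e /= e0 eU]; exists e => // y /cubeP[h1 h2 h3].
rewrite distrC in h1; rewrite distrC in h2; rewrite distrC in h3.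
by apply: eU; split; [split|].
Qed.

End enorm.

(** * Dilation of densities and of the energy *)

Section scaling.
Context {R : realType}.
Implicit Types (f : R3 R -> R) (a b m : R).

Lemma densitiesP m f : densities m f <->
  [/\ measurable_fun [set: R3 R] f, forall x, 0 <= f x,
      (\int[@lebesgue3 R]_x (f x `^ (4 / 3))%:E < +oo)%E
    & (\int[@lebesgue3 R]_x (f x)%:E = m%:E)%E].
Proof.
have r0 : (4 / 3 : R) != 0 by rewrite gt_eqF//; lra.
have normE : (forall x, 0 <= f x) ->
    (\int[@lebesgue3 R]_x (f x `^ (4 / 3))%:E =
     'N[@lebesgue3 R]_(4 / 3)%:E[EFin \o f] `^ (4 / 3))%E.
  move=> f0; rewrite (poweR_Lnorm _ _ r0); apply: eq_integral => x _ /=.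
  by rewrite ger0_norm.
split=> [[+ f0 fm]|[mf f0 + fm]].
  rewrite inE => /andP[/set_mem mf]; rewrite !inE/= /finite_norm => foo.
  by split => //; rewrite normE//; exact: poweR_lty.
rewrite normE// => /(lty_poweRy r0) foo.
by split => //; rewrite inE; apply/andP; split; rewrite inE.
Qed.

Lemma integral_dilation b (g : R3 R -> \bar R) : 0 < b ->
  measurable_fun [set: R3 R] g -> (forall x, 0 <= g x)%E ->
  (\int[@lebesgue3 R]_x g (b *: x) = (b ^- 3)%:E * \int[@lebesgue3 R]_x g x)%E.
Proof.
move=> b0 mg g0; have [_ H] := scales_measure_dilation b0.
by rewrite (H g mg g0) muleA -EFinM mulVf ?mul1e// expf_neq0// gt_eqF.
Qed.

Definition dilate a b f : R3 R -> R := fun x => a * f (b *: x).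

Lemma measurable_dilate a b f : 0 < b -> measurable_fun [set: R3 R] f ->
  measurable_fun [set: R3 R] (dilate a b f).
Proof.
move=> b0 mf; apply: measurable_funM => //.
exact: (measurableT_comp mf (scales_measure_dilation b0).1).
Qed.

Lemma integral_dilate_powR a b f r : 0 <= a -> 0 < b ->
  measurable_fun [set: R3 R] f -> (forall x, 0 <= f x) ->
  (\int[@lebesgue3 R]_x (dilate a b f x `^ r)%:E =
   (a `^ r * b ^- 3)%:E * \int[@lebesgue3 R]_x (f x `^ r)%:E)%E.
Proof.
move=> a0 b0 mf f0.
have mfr : measurable_fun [set: R3 R] (fun x => (f x `^ r)%:E).
  by apply/measurable_EFinP; exact: (measurableT_comp (measurable_powR r) mf).
under eq_integral => x _ do rewrite powRM// EFinM.
rewrite ge0_integralZl_EFin; last 4 first.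
- exact: measurableT.
- by move=> x _; rewrite lee_fin powR_ge0.
- exact: (measurableT_comp mfr (scales_measure_dilation b0).1).
- exact: powR_ge0.
rewrite (@integral_dilation b (fun x => (f x `^ r)%:E))//; last first.
  by move=> x; rewrite lee_fin powR_ge0.
by rewrite muleA -EFinM.
Qed.

Lemma densities_dilate m a b f : 0 < a -> 0 < b -> densities m f ->
  densities (a * b ^- 3 * m) (dilate a b f).
Proof.
move=> a0 b0 /densitiesP[mf f0 foo fm]; apply/densitiesP.
have d0 x : 0 <= dilate a b f x by rewrite mulr_ge0// ltW.
split; [exact: measurable_dilate|exact: d0| |].
  rewrite integral_dilate_powR// ?ltW// lte_mul_pinfty// lee_fin.
  by rewrite mulr_ge0 ?powR_ge0// invr_ge0 exprn_ge0// ltW.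
under eq_integral => x _ do rewrite -[dilate a b f x]powRr1//.
rewrite integral_dilate_powR ?ltW// powRr1 ?ltW//.
under eq_integral => x _ do rewrite powRr1//.
by rewrite fm -EFinM.
Qed.

Definition kinetic (K gamma : R) f : \bar R :=
  (\int[@lebesgue3 R]_x (K / (gamma - 1) * f x `^ gamma)%:E)%E.

Definition coulomb f g : \bar R :=
  (\int[@lebesgue3 R \x @lebesgue3 R]_z
    (f z.1 * g z.2 / enorm (z.1 - z.2))%:E)%E.

Definition selfpot f : \bar R := coulomb f f.

Lemma energyE (K gamma : R) f :
  energy K gamma f = (kinetic K gamma f - (2^-1)%:E * selfpot f)%E.
Proof. by []. Qed.

Lemma kineticE (K gamma : R) f : 0 < K -> 1 < gamma ->
  measurable_fun [set: R3 R] f ->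
  kinetic K gamma f =
    ((K / (gamma - 1))%:E * \int[@lebesgue3 R]_x (f x `^ gamma)%:E)%E.
Proof.
move=> K0 g1 mf; rewrite /kinetic; under eq_integral do rewrite EFinM.
rewrite ge0_integralZl_EFin//.
- by move=> x _; rewrite lee_fin powR_ge0.
- by apply/measurable_EFinP; exact: (measurableT_comp (measurable_powR gamma) mf).
- by rewrite divr_ge0// ?ltW// subr_gt0.
Qed.

Lemma kinetic_ge0 (K gamma : R) f : 0 < K -> 1 < gamma ->
  (0 <= kinetic K gamma f)%E.
Proof.
move=> K0 g1; apply: integral_ge0 => x _; rewrite lee_fin mulr_ge0 ?powR_ge0//.
by rewrite divr_ge0// ?ltW// subr_gt0.
Qed.

Lemma kinetic_dilate (K gamma : R) a b f : 0 < K -> 1 < gamma ->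
  0 <= a -> 0 < b -> measurable_fun [set: R3 R] f -> (forall x, 0 <= f x) ->
  kinetic K gamma (dilate a b f) =
    ((a `^ gamma * b ^- 3)%:E * kinetic K gamma f)%E.
Proof.
move=> K0 g1 a0 b0 mf f0; rewrite !kineticE//; last exact: measurable_dilate.
by rewrite integral_dilate_powR// muleCA.
Qed.

Lemma measurable_coulomb f g : measurable_fun [set: R3 R] f ->
  measurable_fun [set: R3 R] g ->
  measurable_fun [set: R3 R * R3 R]
    (fun z : R3 R * R3 R => (f z.1 * g z.2 / enorm (z.1 - z.2))%:E).
Proof.
move=> mf mg; apply/measurable_EFinP/measurable_funM; last exact: measurable_invdist.
apply: measurable_funM.
  exact: (measurableT_comp mf (@measurable_fst _ _ _ _)).
exact: (measurableT_comp mg (@measurable_snd _ _ _ _)).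
Qed.

Lemma coulomb_ge0 f g (z : R3 R * R3 R) : (forall x, 0 <= f x) ->
  (forall x, 0 <= g x) -> (0 <= (f z.1 * g z.2 / enorm (z.1 - z.2))%:E)%E.
Proof. by move=> f0 g0; rewrite lee_fin divr_ge0 ?mulr_ge0// enorm_ge0. Qed.

Lemma selfpot_ge0 f : (forall x, 0 <= f x) -> (0 <= selfpot f)%E.
Proof. by move=> f0; apply: integral_ge0 => z _; exact: coulomb_ge0. Qed.

(** [f] contributes [a^2], the change of variables [b^-6], and the kernel, which
is homogeneous of degree [-1], contributes [b]. *)
Lemma selfpot_dilate a b f : 0 <= a -> 0 < b ->
  measurable_fun [set: R3 R] f -> (forall x, 0 <= f x) ->
  selfpot (dilate a b f) = ((a ^+ 2 * b ^- 5)%:E * selfpot f)%E.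
Proof.
move=> a0 b0 mf f0; have [mphi H] := scales_measure_dilation2 b0.
pose g (z : R3 R * R3 R) := (f z.1 * f z.2 / enorm (z.1 - z.2))%:E.
have mg : measurable_fun [set: R3 R * R3 R] g by exact: measurable_coulomb.
have g0 z : (0 <= g z)%E by exact: coulomb_ge0.
rewrite /selfpot /coulomb (H g mg g0) muleA -EFinM.
have -> : a ^+ 2 * b ^- 5 * b ^+ 6 = a ^+ 2 * b by field; rewrite gt_eqF.
rewrite -ge0_integralZl_EFin ?mulr_ge0 ?exprn_ge0 ?(ltW b0)//; last first.
  exact: (measurableT_comp mg mphi).
apply: eq_integral => z _; rewrite /g/= -EFinM -scalerBr enormZ ?(ltW b0)//.
congr EFin; rewrite invfM /dilate.
have bb : b * b^-1 = 1 by rewrite mulfV// gt_eqF.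
by rewrite -[in LHS](mulr1 (_ / _)) -bb; ring.
Qed.

End scaling.

(** * Rescaling of minimizers *)

Section rescaling.
Context {R : realType} (K gamma : R) (K_gt0 : 0 < K) (gamma_gt : 4 / 3 < gamma).
Implicit Types (f : R3 R -> R) (a b m : R).
Local Notation A := (scaleA gamma).
Local Notation B := (scaleB gamma).
Local Notation q := (3 * gamma - 4).

Let q_gt0 : 0 < q. Proof. by move: gamma_gt; rewrite ltr_pdivrMr//; lra. Qed.
Let gamma_gt1 : 1 < gamma. Proof. by move: q_gt0; lra. Qed.

Lemma scaleA_gt0 m : 0 < m -> 0 < A m. Proof. exact: powR_gt0. Qed.
Lemma scaleB_gt0 m : 0 < m -> 0 < B m. Proof. exact: powR_gt0. Qed.

Lemma powR_inv (m r : R) : 0 < m -> m^-1 `^ r = (m `^ r)^-1.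
Proof. by move=> m0; rewrite -powRN -powR_inv1 ?ltW// -powRrM mulN1r. Qed.

Lemma scaleAV m : 0 < m -> A m^-1 = (A m)^-1. Proof. exact: powR_inv. Qed.
Lemma scaleBV m : 0 < m -> B m^-1 = (B m)^-1. Proof. exact: powR_inv. Qed.

Lemma rescaledE f m : rescaled gamma f m = dilate (A m)^-1 (B m)^-1 f.
Proof. by []. Qed.

Lemma rescaledK f m : 0 < m -> rescaled gamma (rescaled gamma f m) m^-1 = f.
Proof.
move=> m0; apply/funext => x; rewrite /rescaled scaleAV// scaleBV// !invrK.
by rewrite mulrA scalerA mulfV ?mulVf ?mul1r ?scale1r// gt_eqF ?scaleA_gt0 ?scaleB_gt0.
Qed.

Lemma rescaledVK f m : 0 < m -> rescaled gamma (rescaled gamma f m^-1) m = f.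
Proof. by move=> m0; rewrite -{2}(invrK m) rescaledK// invr_gt0. Qed.

Let AV_powR m : 0 < m -> (A m)^-1 = m `^ (2 / q).
Proof. by move=> m0; rewrite -powRN opprK. Qed.

Let BV_powR m : 0 < m -> (B m)^-1 = m `^ (- ((gamma - 2) / q)).
Proof. by move=> m0; rewrite -powRN. Qed.

Let powRDm m r s : 0 < m -> m `^ r * m `^ s = m `^ (r + s).
Proof. by move=> m0; rewrite powRD// (gt_eqF m0) implybT. Qed.

Lemma mass_factor m : 0 < m -> (A m)^-1 * (B m)^-1 ^- 3 = m.
Proof.
move=> m0; rewrite AV_powR// BV_powR// -powR_mulrn ?powR_ge0//.
rewrite -powRrM -powRN powRDm// -[RHS]powRr1 ?ltW//; congr powR.
by field; rewrite gt_eqF.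
Qed.

(** [A] and [B] are chosen for [kinetic_factor] and [selfpot_factor] to have the
same exponent, [mass_factor] being imposed. *)
Definition energy_exp := (5 * gamma - 6) / q.

Lemma kinetic_factor m : 0 < m ->
  (A m)^-1 `^ gamma * (B m)^-1 ^- 3 = m `^ energy_exp.
Proof.
move=> m0; rewrite AV_powR// BV_powR// -powR_mulrn ?powR_ge0//.
rewrite -!powRrM -powRN powRDm//; congr powR.
by rewrite /energy_exp; field; rewrite gt_eqF.
Qed.

Lemma selfpot_factor m : 0 < m ->
  (A m)^-1 ^+ 2 * (B m)^-1 ^- 5 = m `^ energy_exp.
Proof.
move=> m0; rewrite AV_powR// BV_powR// -!powR_mulrn ?powR_ge0//.
rewrite -!powRrM -powRN powRDm//; congr powR.
by rewrite /energy_exp; field; rewrite gt_eqF.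
Qed.

(** Infinite arguments are included, with [+oo - +oo = -oo]: the kinetic energy of
a density may be infinite. *)
Lemma ge0_muleBr (c : R) (x y : \bar R) : 0 < c -> (0 <= x -> 0 <= y ->
  c%:E * (x - y) = c%:E * x - c%:E * y)%E.
Proof.
move=> c0; case: x y => [x| |] [y| |]// _ _.
- by rewrite -EFinB -!EFinM mulrBr EFinB.
- by rewrite /= !(gt0_mulye, gt0_muley, gt0_muleNy) ?lte_fin.
- by rewrite /= !(gt0_mulye, gt0_muley, gt0_muleNy) ?lte_fin.
- by rewrite /= !(gt0_mulye, gt0_muley, gt0_muleNy) ?lte_fin.
Qed.

Lemma energy_rescaled f m : 0 < m -> measurable_fun [set: R3 R] f ->
  (forall x, 0 <= f x) ->
  energy K gamma (rescaled gamma f m) = ((m `^ energy_exp)%:E * energy K gamma f)%E.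
Proof.
move=> m0 mf f0; have a0 := scaleA_gt0 m0; have b0 := scaleB_gt0 m0.
have iA0 : 0 <= (A m)^-1 by rewrite invr_ge0 ltW.
have iB0 : 0 < (B m)^-1 by rewrite invr_gt0.
rewrite !energyE rescaledE kinetic_dilate// selfpot_dilate//.
rewrite kinetic_factor// selfpot_factor// muleCA; apply/esym/ge0_muleBr.
- exact: powR_gt0.
- exact: kinetic_ge0.
- by rewrite mule_ge0 ?lee_fin ?selfpot_ge0// invr_ge0.
Qed.

Lemma densities_rescaled M f m : 0 < m -> densities M f ->
  densities (m * M) (rescaled gamma f m).
Proof.
move=> m0 fM; rewrite -{1}(mass_factor m0) rescaledE; apply: densities_dilate => //.
- by rewrite invr_gt0 scaleA_gt0.
- by rewrite invr_gt0 scaleB_gt0.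
Qed.

(** A competitor of mass [m * M] is the rescaling of one of mass [M], since
rescaling by [m^-1] undoes rescaling by [m]. *)
Lemma is_minimizer_rescaled M f m : 0 < m -> is_minimizer K gamma M f ->
  is_minimizer K gamma (m * M) (rescaled gamma f m).
Proof.
move=> m0 [fM fmin]; split => [|g gM]; first exact: densities_rescaled.
have mV0 : 0 < m^-1 by rewrite invr_gt0.
have [mf f0 _ _] := (densitiesP _ _).1 fM.
have := densities_rescaled mV0 gM; rewrite mulKf ?gt_eqF// => g'M.
have [mg g0 _ _] := (densitiesP _ _).1 g'M.
rewrite -[g](rescaledVK _ m0) energy_rescaled// [leRHS]energy_rescaled//.
by rewrite lee_wpmul2l ?lee_fin ?powR_ge0// fmin.
Qed.

Lemma ae_dilation b (P : R3 R -> Prop) : 0 < b ->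
  {ae @lebesgue3 R, forall x, P x} -> {ae @lebesgue3 R, forall x, P (b *: x)}.
Proof.
move=> b0 [N [mN N0 PN]]; have [mphi _] := scales_measure_dilation b0.
have mpN : measurable ((fun x : R3 R => b *: x) @^-1` N).
  by rewrite -[X in measurable X]setTI; exact: mphi.
exists ((fun x => b *: x) @^-1` N); split=> //; last by move=> x /= nP; exact: PN.
have iN : (\int[@lebesgue3 R]_x (\1_N x)%:E = 0)%E.
  by rewrite integral_indic// setIT.
suff : (\int[@lebesgue3 R]_x (\1_((fun x => b *: x) @^-1` N) x)%:E = 0)%E.
  by rewrite integral_indic// setIT.
rewrite (@integral_dilation R b (fun x => (\1_N x)%:E))// ?iN ?mule0//.
by apply/measurable_EFinP; exact: measurable_indic.
Qed.

Lemma is_the_minimizer_rescaled M f m : 0 < m -> is_the_minimizer K gamma M f ->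
  is_the_minimizer K gamma (m * M) (rescaled gamma f m).
Proof.
move=> m0 [fmin funiq fcont fsym fdecr].
have a0 := scaleA_gt0 m0; have b0 := scaleB_gt0 m0.
have iB0 : 0 < (B m)^-1 by rewrite invr_gt0.
split.
- exact: is_minimizer_rescaled.
- move=> g gmin; have mV0 : 0 < m^-1 by rewrite invr_gt0.
  have := is_minimizer_rescaled mV0 gmin.
  rewrite mulKf ?gt_eqF// => /funiq[c /(ae_dilation iB0) aeg].
  (* undoing the rescaling dilates the translation vector by B *)
  exists (B m *: c).
  apply: (@filterS _ _ (ae_filter_ringOfSetsType (@lebesgue3 R)) _ _ _ aeg) => x.
  rewrite /rescaled scaleAV// scaleBV// !invrK scalerA mulfV ?gt_eqF// scale1r.
  rewrite scalerBr scalerA mulVf ?gt_eqF// scale1r => <-.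
  by rewrite mulKf ?gt_eqF.
- move=> x; apply: (@continuousM R (R3 R) (cst (A m)^-1)
    (fun x => f ((B m)^-1 *: x))); first exact: cst_continuous.
  apply: continuous_comp; last exact: fcont.
  exact: scaler_continuous.
- by move=> x y xy; rewrite /rescaled; congr *%R; apply: fsym; rewrite !enormZ ?xy// ltW.
- move=> x y xy; rewrite /rescaled ler_pM2l ?invr_gt0//; apply: fdecr.
  by rewrite !enormZ ?(ltW iB0)// ler_pM2l.
Qed.

End rescaling.

(** * Continuous functions, sup norm and support *)

(** Monotonicity without measurability: the integral of a nonnegative function
is a supremum over the simple functions below it. The restrictions of a density to
arbitrary closed sets, which enter the definition of the support, are compared in
this way. *)
Lemma ge0_le_integralT d (T : measurableType d) (R : realType)
    (mu : {measure set T -> \bar R}) (f g : T -> \bar R) :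
  (forall x, 0 <= f x <= g x)%E -> (\int[mu]_x f x <= \int[mu]_x g x)%E.
Proof.
move=> fg; have f0 x : (0 <= f x)%E by have /andP[] := fg x.
have fg' x : (f x <= g x)%E by have /andP[] := fg x.
rewrite !ge0_integralTE//; last by move=> x; exact: le_trans (fg' x).
by apply: le_ereal_sup => _ [h hf <-]; exists h => // x; exact: le_trans (fg' x).
Qed.

Lemma ge0_le_integral_cst d (T : measurableType d) (R : realType)
    (mu : {measure set T -> \bar R}) (f : T -> \bar R) (A : set T) (s : R) :
  measurable A -> 0 <= s -> (forall x, 0 <= f x)%E -> (forall x, A x -> s%:E <= f x)%E ->
  (s%:E * mu A <= \int[mu]_x f x)%E.
Proof.
move=> mA s0 f0 sf; rewrite -integral_cst// integral_mkcond.
apply: ge0_le_integralT => x; rewrite patchE; case: ifPn => xA.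
  by rewrite lee_fin s0/=; apply: sf; exact: set_mem.
by rewrite lexx /=.
Qed.

Section support.
Context {R : realType}.
Implicit Types (f g : R3 R -> R) (c x : R3 R).

Lemma ae_cube (P : R3 R -> Prop) c r : 0 < r ->
  {ae @lebesgue3 R, forall x, P x} -> exists2 x, cube c r x & P x.
Proof.
move=> r0 [N [mN N0 PN]]; apply: contrapT => nP.
have cN : cube c r `<=` N.
  by move=> x cx; apply: PN => Px; apply: nP; exists x.
have : (@lebesgue3 R (cube c r) <= @lebesgue3 R N)%E.
  exact: le_measure (mem_set (measurable_cube c r)) (mem_set mN) cN.
by rewrite [X in (_ <= X)%E]N0 lebesgue3_cube// lee_fin leNgt exprn_gt0// mulr_gt0.
Qed.

Lemma ae_eq_continuous f g : continuous f -> continuous g ->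
  {ae @lebesgue3 R, forall x, f x = g x} -> f =1 g.
Proof.
move=> cf cg fg x; apply/eqP; rewrite -subr_eq0; apply: contrapT => /negP h0.
have : \forall y \near x, f y - g y != 0.
  by apply: (@cvgr_neq0 R R _ (nbhs x) _ (fun y => f y - g y) (f x - g x)) => //;
     apply: cvgB; [exact: cf|exact: cg].
move=> /nbhs_cube[r r0 rP]; have [y /rP + fgy] := ae_cube x r0 fg.
by rewrite fgy subrr eqxx.
Qed.

Lemma lebesgue3_setT_gt0 : (0 < @lebesgue3 R [set: R3 R])%E.
Proof.
apply: (@lt_le_trans _ _ (@lebesgue3 R (cube 0 1))).
  by rewrite lebesgue3_cube// lte_fin exprn_gt0// mulr_gt0.
by apply: le_measure; rewrite ?inE//; exact: measurable_cube.
Qed.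

Lemma near_gt f x (s : R) : continuous f -> s < f x -> \forall y \near x, s < f y.
Proof. by move=> cf; apply: (@cvgr_gt R _ (nbhs x) _ f (f x) (cf x)). Qed.

(** A bound almost everywhere that were smaller than [f 0] would hold at some
point of each cube around [0], against continuity at [0]. *)
Lemma Linfty_norm_max f : continuous f -> (forall x, 0 <= f x) ->
  (forall x, f x <= f 0) -> Linfty_norm f = (f 0)%:E.
Proof.
move=> cf f0 fmax; rewrite /Linfty_norm unlock /Lnorm lebesgue3_setT_gt0.
apply/eqP; rewrite eq_le; apply/andP; split.
  by apply/ess_supP; apply: nearW => x /=; rewrite lee_fin ger0_norm.
have aef := @ess_sup_ge _ _ _ (@lebesgue3 R) (abse \o (EFin \o f)).
rewrite leNgt; apply/negP; case: (ess_sup _ _) aef => [s| |] aef; rewrite ?lte_fin//.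
- move=> sf; have : \forall y \near (0 : R3 R), s < f y.
    exact: near_gt.
  move=> /nbhs_cube[r r0 rP]; have [y /rP + fgy] := ae_cube 0 r0 aef.
  by move: fgy; rewrite /= lee_fin ger0_norm// => /le_lt_trans /[apply]; rewrite ltxx.
- by move=> _; have [y _] := ae_cube 0 ltr01 aef; rewrite leeNy_eq.
Qed.

(** A closed set that misses a point where [f] is positive misses a cube around
it on which [f] is bounded below, and therefore loses a positive part of the
finite mass. *)
Lemma pos_sub_spt f : measurable_fun [set: R3 R] f -> continuous f ->
  (forall x, 0 <= f x) -> (\int[@lebesgue3 R]_x (f x)%:E < +oo)%E ->
  [set x | 0 < f x] `<=` spt f.
Proof.
move=> mf cf f0 foo x /= fx F [cF FE]; apply: contrapT => Fx.
have mfE : measurable_fun [set: R3 R] (EFin \o f) by apply/measurable_EFinP.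
have near1 : \forall y \near x, f x / 2 < f y.
  by apply: near_gt => //; lra.
have near2 : nbhs x (~` F) by apply: open_nbhs_nbhs; split => //; exact: closed_openC.
have [r r0 rP] := nbhs_cube (filterI near1 near2); pose Q := cube x r.
have mQ : measurable Q := measurable_cube x r.
(* Q is disjoint from F *)
have le1 : (\int[@lebesgue3 R]_x (f x)%:E <= \int[@lebesgue3 R]_(x in ~` Q) (f x)%:E)%E.
  rewrite -FE integral_mkcond [leRHS]integral_mkcond.
  apply: ge0_le_integralT => y; rewrite !patchE; case: ifPn => Fy.
    rewrite ifT ?lee_fin ?f0 ?lexx//; apply/mem_set => /rP[_].
    by apply; exact: set_mem.
  by case: ifPn => _; rewrite lexx /= ?lee_fin.
have : (\int[@lebesgue3 R]_(x in ~` Q `|` Q) (f x)%:E =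
   \int[@lebesgue3 R]_(x in ~` Q) (f x)%:E + \int[@lebesgue3 R]_(x in Q) (f x)%:E)%E.
  apply: ge0_integral_setU => //.
  - exact: measurableC.
  - exact: measurable_funS mfE.
  - by move=> y _; rewrite lee_fin.
  - by rewrite disj_set2E setICl.
rewrite setUCl => E.
have le2 : ((f x / 2 * (2 * r) ^+ 3)%:E <= \int[@lebesgue3 R]_(x in Q) (f x)%:E)%E.
  rewrite EFinM -(lebesgue3_cube x r0) -/Q integral_mkcond.
  apply: ge0_le_integral_cst => //; first by rewrite divr_ge0// ltW.
  - by move=> y; rewrite patchE; case: ifPn => // _; rewrite lee_fin.
  - by move=> y Qy; rewrite patchE ifT ?lee_fin ?(ltW (rP _ Qy).1)//; exact: mem_set.
have pos : 0 < f x / 2 * (2 * r) ^+ 3.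
  by rewrite mulr_gt0 ?exprn_gt0 ?mulr_gt0// divr_gt0.
have I0 : (0 <= \int[@lebesgue3 R]_x (f x)%:E)%E.
  by apply: integral_ge0 => y _; rewrite lee_fin.
move: foo E le1 le2 I0; set I := integral _ _ _; set J := integral _ (~` Q) _.
set L := integral _ Q _.
case: I => [i| |]//; case: J => [j| |]//; case: L => [l| |]//=.
by move=> _ [->]; rewrite !lee_fin; lra.
Qed.

Lemma sptE f : measurable_fun [set: R3 R] f -> continuous f ->
  (forall x, 0 <= f x) -> (\int[@lebesgue3 R]_x (f x)%:E < +oo)%E ->
  spt f = closure [set x | 0 < f x].
Proof.
move=> mf cf f0 foo; apply/seteqP; split.
  apply: bigcap_inf; split; first exact: closed_closure.
  rewrite integral_mkcond; congr integral; apply/funext => x.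
  rewrite patchE; case: ifPn => //; rewrite notin_setE => nx.
  have [fx0|fx0] := eqVneq (f x) 0; first by rewrite fx0.
  by exfalso; apply: nx; apply: subset_closure => /=; rewrite lt_neqAle eq_sym fx0 f0.
move=> x clx F [cF FE]; rewrite ((closure_id F).1 cF).
apply: closure_subset clx => y fy; apply: (pos_sub_spt mf cf f0 foo fy).
by split.
Qed.

End support.

(** * Coulomb potential of a bounded density *)

Section potential.
Context {R : realType}.
Implicit Types (f g : R3 R -> R) (x y z : R3 R) (L s v : R).

(** The Coulomb kernel [1/|z|] cut off at the radius [L]. *)
Definition near_kernel L z : R := \1_[set z : R3 R | enorm z < L] z / enorm z.

Lemma near_kernel_ge0 L z : 0 <= near_kernel L z.
Proof. by rewrite divr_ge0// enorm_ge0. Qed.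

Lemma measurable_near_kernel L :
  measurable_fun [set: R3 R] (fun z => (near_kernel L z)%:E).
Proof.
apply/measurable_EFinP/measurable_funM; last exact: measurable_invenorm.
by apply: measurable_indic; exact: measurable_enorm_lt.
Qed.

Lemma dyadic_shell L (t : R) : 0 < L -> 0 < t -> t < L ->
  exists k : nat, L / (2 ^+ k.+1) <= t < L / (2 ^+ k).
Proof.
move=> L0 t0 tL.
have ex : exists n : nat, L / 2 ^+ n <= t.
  exists (Num.truncn (L / t)).+1; rewrite ler_pdivrMr ?exprn_gt0// mulrC -ler_pdivrMr//.
  apply: (le_trans (ltW (truncnS_gt _))).
  by rewrite -natrX ler_nat ltnW// ltn_expl.
case: (ex_minnP ex) => -[|n] Hn min.
  by move: Hn; rewrite expr0 divr1 leNgt tL.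
by exists n; rewrite Hn /= ltNge; apply/negP => /min; rewrite ltnn.
Qed.

(** On the shell where [|z|] lies between [L 2^-(k+1)] and [L 2^-k], the kernel is
at most [2^(k+1) / L] and [z] lies in the cube of half-side [L 2^-k]; so one term
of the series dominates. At [z = 0] the kernel is [0^-1 = 0]. *)
Lemma near_kernel_le L z : 0 < L ->
  ((near_kernel L z)%:E <=
   \sum_(k <oo) (2 ^+ k.+1 / L * \1_(cube (0 : R3 R) (L / 2 ^+ k)) z)%:E)%E.
Proof.
move=> L0.
have t0 k : (0 <= (2 ^+ k.+1 / L * \1_(cube (0 : R3 R) (L / 2 ^+ k)) z)%:E)%E.
  by rewrite lee_fin mulr_ge0// divr_ge0 ?exprn_ge0// ltW.
have [zL|zL] := boolP (z \in [set z : R3 R | enorm z < L]); last first.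
  by rewrite /near_kernel indicE (negbTE zL) mul0r; apply: nneseries_ge0 => k _ _.
rewrite /near_kernel indicE zL mul1r.
have [/eqP|z0] := eqVneq (enorm z) 0.
  by move=> /eqP ->; rewrite invr0; apply: nneseries_ge0 => k _ _.
have zp : 0 < enorm z by rewrite lt_neqAle eq_sym z0 enorm_ge0.
have /= zL' := set_mem zL.
have [k /andP[kz zk]] := dyadic_shell L0 zp zL'.
apply: (@le_trans _ _ (\sum_(0 <= i < k.+1)
    (2 ^+ i.+1 / L * \1_(cube (0 : R3 R) (L / 2 ^+ i)) z)%:E)%E); last first.
  by apply: nneseries_lim_ge => i _ _.
rewrite big_nat_recr//= (le_trans _ (leeDr _ _)) ?sume_ge0//.
rewrite indicE mem_set; last first.
  have [h1 h2 h3] := coord_le_enorm z.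
  by apply/cubeP; rewrite /= !subr0; split; exact: le_lt_trans zk.
rewrite mulr1 lee_fin -[leLHS]mul1r ler_pdivrMr// mulrC.
by move: kz; rewrite ler_pdivrMr ?exprn_gt0// => kz; rewrite mulrA ler_pdivlMr// mul1r.
Qed.

(** Local integrability of [1/|z|] in dimension [3]: the dyadic cubes have volumes
of order [8^-k] and the kernel has size of order [2^k] there, so that the
terms decrease like [4^-k]. *)
Lemma integral_near_kernel L : 0 < L ->
  (\int[@lebesgue3 R]_z (near_kernel L z)%:E <= (32 * L ^+ 2)%:E)%E.
Proof.
move=> L0.
pose u k z := (2 ^+ k.+1 / L * \1_(cube (0 : R3 R) (L / 2 ^+ k)) z)%:E.
have c0 k : 0 <= 2 ^+ k.+1 / L by rewrite divr_ge0 ?exprn_ge0// ltW.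
have mu_ k : measurable_fun [set: R3 R] (u k).
  apply/measurable_EFinP/measurable_funM => //.
  by apply: measurable_indic; exact: measurable_cube.
have u0 k z : (0 <= u k z)%E by rewrite lee_fin mulr_ge0.
apply: (@le_trans _ _ (\int[@lebesgue3 R]_z (\sum_(k <oo) u k z))%E).
  by apply: ge0_le_integralT => z; rewrite near_kernel_le// lee_fin near_kernel_ge0.
rewrite integral_nneseries//.
have -> : (32 * L ^+ 2)%:E = (\sum_(k <oo) (32 * L ^+ 2 / (2 ^ (k + 1))%:R)%:E)%E :> \bar R.
  have := @cvg_geometric_eseries_half R (32 * L ^+ 2) 0.
  by rewrite expr0 divr1 => /cvg_lim <-.
apply: lee_nneseries => [k _ _|k _]; first by apply: integral_ge0 => z _.
have mc : measurable (cube (0 : R3 R) (L / 2 ^+ k)) by exact: measurable_cube.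
have e0 : 0 < 2 ^+ k :> R by rewrite exprn_gt0.
rewrite /u; under eq_integral do rewrite EFinM.
rewrite ge0_integralZl_EFin//; last first.
  by apply/measurable_EFinP; exact: measurable_indic.
rewrite integral_indic// setIT [X in (_ * X)%E]lebesgue3_cube ?divr_gt0//.
rewrite -EFinM lee_fin addn1 natrX exprS.
have -> : 2 * 2 ^+ k / L * (2 * (L / 2 ^+ k)) ^+ 3 = 16 * L ^+ 2 / 2 ^+ k / 2 ^+ k.
  by field; rewrite !gt_eqF.
have -> : 32 * L ^+ 2 / (2 * 2 ^+ k) = 16 * L ^+ 2 / 2 ^+ k.
  by field; rewrite gt_eqF.
rewrite ler_pdivrMr// ler_peMr//; last by rewrite exprn_ege1// ler1n.
by rewrite divr_ge0 ?mulr_ge0 ?exprn_ge0// ltW.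
Qed.

Definition potential f x : \bar R :=
  (\int[@lebesgue3 R]_y (f y / enorm (x - y))%:E)%E.

Lemma potential_ge0 f x : (forall x, 0 <= f x) -> (0 <= potential f x)%E.
Proof.
by move=> f0; apply: integral_ge0 => y _; rewrite lee_fin divr_ge0// enorm_ge0.
Qed.

Lemma measurable_dist x : measurable_fun [set: R3 R] (fun y : R3 R => y - x).
Proof.
have := (@scales_measure_affine3 R 1 (- x) ltr01).1.
by under eq_fun do rewrite scale1r.
Qed.

Lemma integral_shift x (g : R3 R -> \bar R) :
  measurable_fun [set: R3 R] g -> (forall x, 0 <= g x)%E ->
  (\int[@lebesgue3 R]_y g (y - x)%R = \int[@lebesgue3 R]_y g y)%E.
Proof.
move=> mg g0; have [_ H] := @scales_measure_affine3 R 1 (- x) ltr01.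
rewrite (H g mg g0) expr1n mul1e.
by apply: eq_integral => y _; rewrite scale1r.
Qed.

(** The kernel is at most [1/L] away from [x], and [f] is at most [s] near [x]. *)
Lemma potential_le f x L s : 0 < L -> 0 <= s ->
  measurable_fun [set: R3 R] f -> (forall x, 0 <= f x) ->
  (forall y, enorm (x - y) < L -> f y <= s) ->
  (potential f x <=
   (L^-1)%:E * \int[@lebesgue3 R]_y (f y)%:E + (s * (32 * L ^+ 2))%:E)%E.
Proof.
move=> L0 s0 mf f0 fs.
have mk := measurable_near_kernel L.
have mkx : measurable_fun [set: R3 R] (fun y => (near_kernel L (y - x))%:E).
  exact: (measurableT_comp mk (measurable_dist x)).
have mfE : measurable_fun [set: R3 R] (EFin \o f) by exact/measurable_EFinP.
apply: (@le_trans _ _ (\int[@lebesgue3 R]_y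
    ((L^-1)%:E * (f y)%:E + s%:E * (near_kernel L (y - x))%:E))%E).
  apply: ge0_le_integralT => y; rewrite lee_fin divr_ge0 ?enorm_ge0//=.
  rewrite -!EFinM -EFinD lee_fin /near_kernel enorm_distC indicE.
  have [/set_mem /= yL|/negP yL] := boolP (y - x \in [set z : R3 R | enorm z < L]).
    rewrite mul1r -[leLHS]add0r lerD//; first by rewrite mulr_ge0// invr_ge0 ltW.
    by rewrite ler_wpM2r ?invr_ge0 ?enorm_ge0// fs// enorm_distC.
  have Ly : L <= enorm (x - y).
    by rewrite leNgt enorm_distC; apply/negP => h; apply: yL; exact: mem_set.
  rewrite mul0r mulr0 addr0 mulrC ler_wpM2r// lef_pV2 ?posrE//.
  exact: lt_le_trans Ly.
rewrite ge0_integralD//; last 4 first.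
- by move=> y _; rewrite -EFinM lee_fin mulr_ge0// invr_ge0 ltW.
- exact: measurable_funeM.
- by move=> y _; rewrite -EFinM lee_fin mulr_ge0// near_kernel_ge0.
- exact: measurable_funeM.
rewrite ge0_integralZl_EFin//; last 2 first.
- by move=> y _; rewrite lee_fin.
- by rewrite invr_ge0 ltW.
rewrite leeD2l// ge0_integralZl_EFin//; last first.
  by move=> y _; rewrite lee_fin near_kernel_ge0.
rewrite EFinM lee_wpmul2l ?lee_fin//.
rewrite (@integral_shift x (fun z => (near_kernel L z)%:E))//.
  exact: integral_near_kernel.
by move=> y; rewrite lee_fin near_kernel_ge0.
Qed.

(** Integrating first against [g] produces the potential of [g]. Both orders of
the factors are needed, because cutting a density produces both cross terms. *)
Lemma coulomb_le_potential f g v :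
  measurable_fun [set: R3 R] f -> measurable_fun [set: R3 R] g ->
  (forall x, 0 <= f x) -> (forall x, 0 <= g x) ->
  (forall x, f x != 0 -> (potential g x <= v%:E)%E) ->
  (coulomb f g <= v%:E * \int[@lebesgue3 R]_x (f x)%:E)%E /\
  (coulomb g f <= v%:E * \int[@lebesgue3 R]_x (f x)%:E)%E.
Proof.
move=> mf mg f0 g0 fv.
have mfE : measurable_fun [set: R3 R] (EFin \o f) by exact/measurable_EFinP.
have v0 x : f x != 0 -> 0 <= v.
  by move=> /fv; rewrite -lee_fin; apply: le_trans; exact: potential_ge0.
have mpot : measurable_fun [set: R3 R] (fun x => (f x)%:E * potential g x)%E.
  apply: emeasurable_funM => //.
  have mk : measurable_fun [set: R3 R * R3 R]
      (fun z : R3 R * R3 R => (g z.2 / enorm (z.1 - z.2))%:E).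
    apply/measurable_EFinP/measurable_funM; last exact: measurable_invdist.
    exact: (measurableT_comp mg (@measurable_snd _ _ _ _)).
  apply: (@measurable_fun_fubini_tonelli_F _ _ _ _ R (@lebesgue3 R) _ mk).
  by move=> z; rewrite lee_fin divr_ge0// enorm_ge0.
have inner x : (\int[@lebesgue3 R]_y (f x * g y / enorm (x - y))%:E =
    (f x)%:E * potential g x)%E.
  rewrite -ge0_integralZl_EFin//.
  - by apply: eq_integral => y _; rewrite -EFinM mulrA.
  - by move=> y _; rewrite lee_fin divr_ge0// enorm_ge0.
  - apply/measurable_EFinP/measurable_funM => //.
    under eq_fun do rewrite enorm_distC.
    exact: (measurableT_comp measurable_invenorm (measurable_dist x)).
have outer : (\int[@lebesgue3 R]_x ((f x)%:E * potential g x) <=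
    v%:E * \int[@lebesgue3 R]_x (f x)%:E)%E.
  have [fx0|/existsNP[x0 /eqP/v0 v_ge0]] := pselect (forall x, f x = 0).
    under eq_integral do rewrite fx0 mul0e.
    under [X in (_ <= _ * X)%E]eq_integral do rewrite fx0.
    by rewrite integral0 mule0.
  rewrite -ge0_integralZl_EFin//; last by move=> x _; rewrite lee_fin.
  apply: ge0_le_integralT => x; rewrite mule_ge0 ?lee_fin ?potential_ge0//=.
  have [->|fx0] := eqVneq (f x) 0; first by rewrite mul0e mule0.
  by rewrite muleC lee_wpmul2r ?lee_fin// fv.
split.
  rewrite /coulomb fubini_tonelli1; last 2 first.
  - exact: measurable_coulomb.
  - by move=> z; exact: coulomb_ge0.
  by rewrite /fubini_F; under eq_integral do rewrite inner.
rewrite /coulomb fubini_tonelli2; last 2 first.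
- exact: measurable_coulomb.
- by move=> z; exact: coulomb_ge0.
rewrite /fubini_G; under eq_integral => y _.
  under eq_integral => x _ do rewrite /= (mulrC (g x)) enorm_distC.
  rewrite inner.
  over.
exact: outer.
Qed.

End potential.

(** * The minimizer has compact support *)

Section compact_support.
Context {R : realType}.
Implicit Types (f : R3 R -> R) (x y : R3 R).

Lemma cube_mass_le f c (r s : R) : 0 < r -> 0 <= s -> (forall x, 0 <= f x) ->
  (forall x, cube c r x -> s <= f x) ->
  ((s * (2 * r) ^+ 3)%:E <= \int[@lebesgue3 R]_x (f x)%:E)%E.
Proof.
move=> r0 s0 f0 sf; rewrite EFinM -(lebesgue3_cube c r0).
apply: ge0_le_integral_cst => //; first exact: measurable_cube.
Qed.

(** If [f] exceeds [s] at a point far enough, then it does so on a cube of volume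
greater than [s^-1], which then carries more than unit mass. *)
Lemma decr_cvg0 f : (forall x, 0 <= f x) ->
  (forall x y, enorm x <= enorm y -> f y <= f x) ->
  (\int[@lebesgue3 R]_x (f x)%:E <= 1)%E ->
  forall s : R, 0 < s -> exists rho, forall x, rho <= enorm x -> f x <= s.
Proof.
move=> f0 fdecr f1 s s0; pose r := (1 + s^-1) / 2.
have sV0 : 0 < s^-1 by rewrite invr_gt0.
have r0 : 0 < r by rewrite divr_gt0// addr_gt0.
exists (2 * r) => x rx; rewrite leNgt; apply/negP => sfx.
have : ((s * (2 * r) ^+ 3)%:E <= \int[@lebesgue3 R]_x (f x)%:E)%E.
  apply: (@cube_mass_le f 0) => // [|y]; first exact: ltW.
  move=> /cubeP; rewrite /= !subr0 => -[h1 h2 h3].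
  apply: (le_trans (ltW sfx)); apply: fdecr; apply: le_trans rx.
  by apply: enorm_le_coord; exact: ltW.
move=> /le_trans /(_ f1); rewrite lee_fin leNgt => /negP; apply.
have -> : 2 * r = 1 + s^-1 by rewrite /r; field; rewrite gt_eqF.
apply: (@lt_le_trans _ _ (s * (1 + s^-1))).
  by rewrite mulrDr mulr1 mulfV ?gt_eqF// ltrDr.
by rewrite ler_pM2l// ler_eXnr// lerDl ltW.
Qed.

(** The integrand vanishes on the diagonal, where [0^-1 = 0], so it is bounded below
on the product of two disjoint cubes near [0]. *)
Lemma selfpot_gt0 f : continuous f -> measurable_fun [set: R3 R] f ->
  (forall x, 0 <= f x) -> 0 < f 0 -> (0 < selfpot f)%E.
Proof.
move=> cf mf f0 f00.
have near0 : \forall y \near (0 : R3 R), f 0 / 2 < f y.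
  by apply: near_gt => //; lra.
have [r r0 rP] := nbhs_cube near0.
pose c1 : R3 R := (r / 2, 0, 0); pose c2 : R3 R := (- (r / 2), 0, 0).
pose Q := cube c1 (r / 4) `*` cube c2 (r / 4).
have mQ : measurable Q by apply: measurableX; exact: measurable_cube.
have r4 : 0 < r / 4 by lra.
pose s := (f 0 / 2) ^+ 2 / (4 * r).
have s0 : 0 < s by rewrite divr_gt0 ?exprn_gt0 ?mulr_gt0// divr_gt0.
have QE : ((@lebesgue3 R \x @lebesgue3 R) Q = ((2 * (r / 4)) ^+ 3 * (2 * (r / 4)) ^+ 3)%:E)%E.
  rewrite product_measure1E//; [|exact: measurable_cube|exact: measurable_cube].
  by rewrite [X in (X * _)%E]lebesgue3_cube// [X in (_ * X)%E]lebesgue3_cube// -EFinM.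
apply: (@lt_le_trans _ _ (s%:E * (@lebesgue3 R \x @lebesgue3 R) Q)%E).
  by rewrite QE -EFinM lte_fin mulr_gt0// mulr_gt0// exprn_gt0// mulr_gt0.
apply: ge0_le_integral_cst => //; first exact: ltW.
  by move=> z; exact: coulomb_ge0.
move=> [x y] [/= /cubeP[/= x1 x2 x3] /cubeP[/= y1 y2 y3]].
(* both cubes lie in the cube of half-side r, and the first coordinates differ *)
have inside (u t : R) : `|u| <= r / 2 -> `|t - u| < r / 4 -> `|t| < r.
  by rewrite ler_norml !ltr_norml => /andP[? ?] /andP[? ?]; apply/andP; split; lra.
have diff (t u : R) : `|t| < r -> `|u| < r -> `|t - u| <= 2 * r.
  by rewrite ler_norml !ltr_norml => /andP[? ?] /andP[? ?]; apply/andP; split; lra.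
have apart (t u : R) : `|t - r / 2| < r / 4 -> `|u - - (r / 2)| < r / 4 -> 0 < t - u.
  by rewrite !ltr_norml => /andP[? ?] /andP[? ?]; lra.
have r2 : `|r / 2| <= r / 2 by rewrite ger0_norm// divr_ge0// ltW.
have z2 : `|0 : R| <= r / 2 by rewrite normr0 divr_ge0// ltW.
have n2 : `|- (r / 2)| <= r / 2 by rewrite normrN.
have d0 := apart _ _ x1 y1.
move/inside: x1 => /(_ r2) x1; move/inside: x2 => /(_ z2) x2; move/inside: x3 => /(_ z2) x3.
move/inside: y1 => /(_ n2) y1; move/inside: y2 => /(_ z2) y2; move/inside: y3 => /(_ z2) y3.
have fx : f 0 / 2 < f x by apply: rP; apply/cubeP; rewrite /= !subr0.
have fy : f 0 / 2 < f y by apply: rP; apply/cubeP; rewrite /= !subr0.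
have e0 : 0 < enorm (x - y).
  have [+ _ _] := coord_le_enorm (x - y); apply: lt_le_trans.
  by rewrite normr_gt0 gt_eqF.
have e1 : enorm (x - y) <= 4 * r.
  have -> : 4 * r = 2 * (2 * r) by ring.
  by apply: enorm_le_coord; exact: diff.
rewrite lee_fin /s ler_pM//.
- by rewrite exprn_ge0// divr_ge0// ltW.
- by rewrite invr_ge0 mulr_ge0// ltW.
- by rewrite expr2 ler_pM ?divr_ge0// ltW.
- by rewrite lef_pV2// posrE// mulr_gt0.
Qed.

Section minimizer.
Variables (K gamma : R) (K_gt0 : 0 < K) (gamma_gt : 4 / 3 < gamma).
Variables (sigma : R3 R -> R) (sigma_min : is_the_minimizer K gamma 1 sigma).
Local Notation q := (3 * gamma - 4).

Let q_gt0 : 0 < q. Proof. by move: gamma_gt; rewrite ltr_pdivrMr//; lra. Qed.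
Let gamma_gt1 : 1 < gamma. Proof. by move: q_gt0; lra. Qed.
Let cont : continuous sigma := the_minimizer_cont sigma_min.
Let decr := the_minimizer_decr sigma_min.
Let dens : densities 1 sigma := (the_minimizer_min sigma_min).1.
Let meas : measurable_fun [set: R3 R] sigma.
Proof. by have /densitiesP[] := dens. Qed.
Let ge0 x : 0 <= sigma x.
Proof. by have /densitiesP[_ + _ _] := dens; apply. Qed.
Let mass : (\int[@lebesgue3 R]_x (sigma x)%:E = 1)%E.
Proof. by have /densitiesP[] := dens. Qed.
Let le_center x : sigma x <= sigma 0.
Proof. by apply: decr; rewrite enorm0 enorm_ge0. Qed.

Lemma center_gt0 : 0 < sigma 0.
Proof.
rewrite lt_neqAle ge0 andbT eq_sym; apply/eqP => s0.
have := mass; under eq_integral => x _.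
  have -> : sigma x = 0 by apply/eqP; rewrite eq_le ge0 -s0 le_center.
  over.
by rewrite integral0 => -[/eqP]; rewrite eq_sym oner_eq0.
Qed.

(** [sigma^gamma <= sigma(0)^(gamma - 1) sigma]. *)
Lemma kinetic_lty : (kinetic K gamma sigma < +oo)%E.
Proof.
have g1 := gamma_gt1.
have mE : measurable_fun [set: R3 R] (EFin \o sigma) by exact/measurable_EFinP.
rewrite kineticE// lte_mul_pinfty//.
  by rewrite lee_fin divr_ge0 ?ltW// subr_gt0.
apply: (@le_lt_trans _ _ (\int[@lebesgue3 R]_x
    ((sigma 0 `^ (gamma - 1))%:E * (sigma x)%:E))%E).
  apply: ge0_le_integralT => x; rewrite lee_fin powR_ge0/= -EFinM lee_fin.
  rewrite -mulr_powRB1//; last by lra.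
  rewrite mulrC ler_wpM2r//.
  by apply: ge0_ler_powR => //; rewrite ?nnegrE//; lra.
rewrite ge0_integralZl_EFin// ?powR_ge0//.
  by rewrite mass mule1 ltry.
by move=> x _; rewrite lee_fin.
Qed.

Lemma selfpot_lty : (selfpot sigma < +oo)%E.
Proof.
pose v := 1^-1 * 1 + sigma 0 * (32 * 1 ^+ 2).
have Vv x : (potential sigma x <= v%:E)%E.
  by have := @potential_le R sigma x 1 (sigma 0) ltr01 (ge0 0) meas ge0
    (fun y _ => le_center y); rewrite mass.
have [+ _] := @coulomb_le_potential R sigma sigma v meas meas ge0 ge0 (fun x _ => Vv x).
by move=> /le_lt_trans; apply; rewrite mass mule1 ltry.
Qed.

(** Spreading [sigma] out as [t^3 sigma(t x)] with small [t] makes the energy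
negative. *)
Lemma energy_lt0 : exists2 e : R, 0 < e & energy K gamma sigma = (- e)%:E.
Proof.
have T0 : (0 <= kinetic K gamma sigma)%E by exact: kinetic_ge0.
have W0 := selfpot_gt0 cont meas ge0 center_gt0.
have Too := kinetic_lty; have Woo := selfpot_lty.
have H t : 0 < t -> (energy K gamma sigma <=
   (t `^ (3 * gamma - 3))%:E * kinetic K gamma sigma -
   (2^-1)%:E * (t%:E * selfpot sigma))%E.
  move=> t0; have t3 : 0 < t ^+ 3 by rewrite exprn_gt0.
  have := densities_dilate t3 t0 dens.
  rewrite mulfV ?gt_eqF// mulr1 => /(the_minimizer_min sigma_min).2.
  rewrite energyE [in leRHS]energyE kinetic_dilate// ?(ltW t3)// selfpot_dilate// ?(ltW t3)//.
  have -> : (t ^+ 3) ^+ 2 / t ^+ 5 = t by field; rewrite gt_eqF.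
  suff -> : (t ^+ 3) `^ gamma / t ^+ 3 = t `^ (3 * gamma - 3) by [].
  rewrite -powR_mulrn ?ltW// -powRrM -powRN -powRD//.
  by rewrite (gt_eqF t0) implybT.
rewrite energyE in H *.
move: T0 W0 Too Woo H; case: (kinetic _ _ _) => [T| |]//; case: (selfpot _) => [W| |]//.
rewrite !(lee_fin, lte_fin) => T0 W0 _ _ H.
exists (W / 2 - T); last by rewrite -EFinM -EFinB; congr EFin; lra.
(* with t^(3 gamma - 4) = c, the energy of the dilate is t (c T - W / 2) *)
pose c := W / (2 * (T + 1)).
have c0 : 0 < c by rewrite divr_gt0// mulr_gt0// ltr_wpDl.
pose t := c `^ q^-1; have t0 : 0 < t by exact: powR_gt0.
have tq : t `^ (3 * gamma - 3) = t * c.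
  have -> : 3 * gamma - 3 = 1 + q by ring.
  rewrite powRD; last by rewrite (gt_eqF t0) implybT.
  by rewrite powRr1 ?ltW// /t -(powRrM c) mulVf ?gt_eqF// powRr1// ltW.
have := H t t0; rewrite tq -!EFinM -!EFinB lee_fin.
have cT : c * T < W / 2.
  rewrite /c mulrAC ltr_pdivrMr ?mulr_gt0 ?ltr_wpDl//.
  have -> : W / 2 * (2 * (T + 1)) = W * T + W by field.
  by rewrite ltrDl.
have : 0 < t * (W / 2 - c * T) by rewrite mulr_gt0// subr_gt0.
by lra.
Qed.

(** [potential_le] with [L] large, then [s] small in terms of [L]. *)
Lemma potential_cvg0 (v : R) : 0 < v -> exists2 rho : R, 0 < rho &
  forall x, rho <= enorm x -> (potential sigma x <= v%:E)%E.
Proof.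
move=> v0; pose L := 2 / v; have L0 : 0 < L by rewrite divr_gt0.
pose s := v / 2 / (32 * L ^+ 2).
have s0 : 0 < s by rewrite !(divr_gt0, mulr_gt0, exprn_gt0).
have m1 : (\int[@lebesgue3 R]_x (sigma x)%:E <= 1)%E by rewrite mass.
have [rho rhoP] := decr_cvg0 ge0 decr m1 s0.
exists (`|rho| + L) => [|x rx]; first by rewrite ltr_wpDl.
have := @potential_le R sigma x L s L0 (ltW s0) meas ge0.
rewrite mass mule1 -EFinD.
have -> : L^-1 + s * (32 * L ^+ 2) = v.
  by rewrite /s /L; field; rewrite gt_eqF.
apply => y xy; apply: rhoP; apply: (le_trans (ler_norm _)).
have := enorm_triangle (x - y) y; rewrite subrK; lra.
Qed.

(** Cut [sigma] into a core and a tail at a radius [r] beyond which its potential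
is at most [e/2], where [- e] is its energy. A unit of mass of the tail lowers the
energy by at most [e/2], but it would lower it by at least [e] if it were used to
rescale the core to mass [1]. *)
Lemma compact_support : exists2 r : R, 0 < r & spt sigma `<=` [set x | enorm x <= r].
Proof.
have g1 := gamma_gt1; have q0 := q_gt0; have [e e0 Ee] := energy_lt0.
have [r r0 rP] := potential_cvg0 (divr_gt0 e0 (ltr0n _ 2)).
exists r => //.
pose D := [set x : R3 R | enorm x < r].
have mD : measurable D by exact: measurable_enorm_lt.
pose core x := sigma x * \1_D x; pose tail x := sigma x * \1_(~` D) x.
have mcore : measurable_fun [set: R3 R] core.
  by apply: measurable_funM => //; exact: measurable_indic.
have mtail : measurable_fun [set: R3 R] tail.
  by apply: measurable_funM => //; apply: measurable_indic; exact: measurableC.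
have core0 x : 0 <= core x by rewrite mulr_ge0.
have tail0 x : 0 <= tail x by rewrite mulr_ge0.
have split x : sigma x = core x + tail x.
  by rewrite /core /tail !indicE in_setC -mulrDr; case: (x \in D); rewrite /= ?(addr0, add0r) mulr1.
have core_le x : core x <= sigma x by rewrite split lerDl.
have mass_split : (\int[@lebesgue3 R]_x (core x)%:E + \int[@lebesgue3 R]_x (tail x)%:E = 1)%E.
  rewrite -ge0_integralD//.
  - by rewrite -mass; apply: eq_integral => x _; rewrite split EFinD.
  - by move=> x _; rewrite lee_fin.
  - exact/measurable_EFinP.
  - by move=> x _; rewrite lee_fin.
  - exact/measurable_EFinP.
have core_pos : exists2 d : R, 0 < d & (d%:E <= \int[@lebesgue3 R]_x (core x)%:E)%E.
  have near1 : \forall y \near (0 : R3 R), sigma 0 / 2 < sigma y.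
    apply: near_gt => //.
    by have := center_gt0; lra.
  have near2 : \forall y \near (0 : R3 R), enorm y < r.
    apply: (@cvgr_lt R _ (nbhs (0 : R3 R)) _ (@enorm R) (enorm (0 : R3 R)) (@continuous_enorm R 0)).
    by rewrite enorm0.
  have [d d0 dP] := nbhs_cube (filterI near1 near2).
  exists (sigma 0 / 2 * (2 * d) ^+ 3).
    by rewrite !(mulr_gt0, exprn_gt0, divr_gt0)// center_gt0.
  apply: (@cube_mass_le core 0) => //; first by rewrite divr_ge0.
  move=> x /dP[sx xr]; rewrite /core indicE mem_set//= mulr1; exact: ltW.
have [d d0 dcore] := core_pos.
have tail_ge0 : (0 <= \int[@lebesgue3 R]_x (tail x)%:E)%E.
  by apply: integral_ge0 => x _; rewrite lee_fin.
have pot_tail x : tail x != 0 -> (potential sigma x <= (e / 2)%:E)%E.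
  move=> tx; apply: rP; rewrite leNgt; apply/negP => xr.
  by move: tx; rewrite /tail indicE in_setC mem_set// mulr0 eqxx.
have [ct1 ct2] := coulomb_le_potential mtail meas tail0 ge0 pot_tail.
(* sigma sigma' = core core' + tail sigma' + core tail', and core <= sigma *)
have Wle : (selfpot sigma <= selfpot core + (coulomb tail sigma + coulomb sigma tail))%E.
  rewrite /selfpot /coulomb -ge0_integralD//; last 4 first.
  - by move=> z _; exact: coulomb_ge0.
  - exact: measurable_coulomb.
  - by move=> z _; exact: coulomb_ge0.
  - exact: measurable_coulomb.
  rewrite -ge0_integralD//; last 4 first.
  - by move=> z _; exact: coulomb_ge0.
  - exact: measurable_coulomb.
  - by move=> z _; apply: adde_ge0; exact: coulomb_ge0.
  - by apply: emeasurable_funD; exact: measurable_coulomb.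
  apply: ge0_le_integralT => z; rewrite coulomb_ge0//= -!EFinD lee_fin -!mulrDl.
  rewrite ler_wpM2r ?invr_ge0 ?enorm_ge0//.
  have := split z.1; have := split z.2; have := core0 z.1; have := core0 z.2.
  by have := tail0 z.1; have := tail0 z.2; nra.
have Tle : (kinetic K gamma core <= kinetic K gamma sigma)%E.
  apply: ge0_le_integralT => x.
  have k0 : 0 <= K / (gamma - 1) by rewrite divr_ge0 ?ltW// subr_gt0.
  rewrite !lee_fin mulr_ge0 ?powR_ge0//= ler_wpM2l//.
  by apply: ge0_ler_powR; rewrite ?nnegrE//; lra.
have T0 : (0 <= kinetic K gamma core)%E by exact: kinetic_ge0.
have W0 : (0 <= selfpot core)%E by exact: selfpot_ge0.
have Wsub : (selfpot core <= selfpot sigma)%E.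
  apply: ge0_le_integralT => z; rewrite coulomb_ge0//= lee_fin.
  by rewrite ler_wpM2r ?invr_ge0 ?enorm_ge0// ler_pM.
(* the core, rescaled to mass 1, is a competitor *)
have key : forall eps : R, (\int[@lebesgue3 R]_x (tail x)%:E = eps%:E)%E ->
    (\int[@lebesgue3 R]_x (core x)%:E = (1 - eps)%:E)%E -> 0 < 1 - eps ->
    ((- e * (1 - eps))%:E <= energy K gamma core)%E.
  move=> eps Et Ec m0.
  have dcore1 : densities (1 - eps) core.
    apply/densitiesP; split => //.
    have /densitiesP[_ _ + _] := dens; apply: le_lt_trans.
    apply: ge0_le_integralT => x; rewrite !lee_fin powR_ge0/=.
    by apply: ge0_ler_powR; rewrite ?nnegrE//; lra.
  have iV0 : 0 < (1 - eps)^-1 by rewrite invr_gt0.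
  have := densities_rescaled gamma_gt iV0 dcore1.
  rewrite mulVf ?gt_eqF// => /(the_minimizer_min sigma_min).2.
  rewrite Ee energy_rescaled//; set p := energy_exp gamma.
  rewrite powR_inv// => le1.
  have pos : 0 < (1 - eps) `^ p by exact: powR_gt0.
  have le2 : (((1 - eps) `^ p * - e)%:E <= energy K gamma core)%E.
    rewrite EFinM; apply: (@le_trans _ _ (((1 - eps) `^ p)%:E *
      (((1 - eps) `^ p)^-1%:E * energy K gamma core))%E).
      by rewrite lee_wpmul2l// lee_fin ltW.
    by rewrite muleA -EFinM mulfV ?gt_eqF// mul1e.
  apply: le_trans le2; rewrite lee_fin mulrN mulNr lerN2 mulrC.
  rewrite ler_pM2l//; apply: ge1r_powR.
    rewrite m0/=; move: tail_ge0; rewrite Et lee_fin; lra.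
  rewrite /p /energy_exp ler_pdivlMr//; lra.
have tail_eq0 : (\int[@lebesgue3 R]_x (tail x)%:E = 0)%E.
  move: (mass_split) (tail_ge0) (dcore) (ct1) (ct2) (key).
  case: (\int[@lebesgue3 R]_x (core x)%:E)%E => [mc| |]//;
  case: (\int[@lebesgue3 R]_x (tail x)%:E)%E => [eps| |]// [mce].
  rewrite !lee_fin => eps0 dmc ct1' ct2' key'; congr EFin.
  have := key' eps erefl; rewrite -mce addrK => /(_ erefl (lt_le_trans d0 dmc)).
  move: Ee Tle T0 W0 Wle Wsub; rewrite !energyE.
  have := kinetic_lty; have := selfpot_lty.
  have : (0 <= kinetic K gamma sigma)%E by exact: kinetic_ge0.
  have : (0 <= selfpot sigma)%E by exact: selfpot_ge0.
  case: (kinetic _ _ sigma) => [t| |]//; case: (selfpot sigma) => [w| |]//.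
  case: (kinetic _ _ core) => [t'| |]//; case: (selfpot core) => [w'| |]//.
  move: ct1' ct2'; rewrite -EFinM.
  have c1 : (0 <= coulomb tail sigma)%E.
    by apply: integral_ge0 => z _; exact: coulomb_ge0.
  have c2 : (0 <= coulomb sigma tail)%E.
    by apply: integral_ge0 => z _; exact: coulomb_ge0.
  move: c1 c2; case: (coulomb tail sigma) => [a| |]//; case: (coulomb sigma tail) => [b| |]//.
  rewrite -!EFinM -!EFinN -!EFinD !lee_fin => a0 b0 ae be _ _ _ _ [Ee'] Tle T0 W0 Wle Wsub.
  have -> : mc = 1 - eps by lra.
  move=> H; have : e * eps <= 0 by lra.
  by rewrite pmulr_rle0// => epsle; apply/eqP; rewrite eq_le epsle.
have core1 : (\int[@lebesgue3 R]_x (core x)%:E = 1)%E.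
  by rewrite -mass_split tail_eq0 adde0.
(* the closed ball of radius r carries the mass of the core, which is 1 *)
apply: bigcap_inf; split.
  apply: (@closed_comp _ _ (@enorm R) [set y | y <= r]); last exact: closed_le.
  by move=> x _; exact: continuous_enorm.
apply/eqP; rewrite eq_le mass integral_mkcond; apply/andP; split.
  rewrite -mass; apply: ge0_le_integralT => x; rewrite patchE.
  by case: ifPn => _; rewrite !lee_fin ge0 lexx.
rewrite -core1; apply: ge0_le_integralT => x; rewrite lee_fin core0 patchE /=.
case: ifPn => [_|xr]; first by rewrite lee_fin core_le.
rewrite /core indicE memNset ?mulr0//= => xD; move/negP: xr; apply; apply/mem_set.
exact: ltW.
Qed.

End minimizer.
End compact_support.

(** * Limits of powers at the right of zero *)

Section limits.
Context {R : realType}.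
Implicit Types (c p : R).

Lemma cvg_scaled_powR0 c p : 0 < p -> c * m `^ p @[m --> 0^'+] --> (0 : R).
Proof.
move=> /powR_cvg0 /(cvgM (cvg_cst c)) H.
by rewrite mulr0 in H.
Qed.

Lemma cvg_scaled_powRy c p : 0 < c -> 0 < p ->
  c * m `^ (- p) @[m --> (0 : R)^'+] --> +oo.
Proof.
move=> c0 p0; apply/gtr0_cvgV0.
  near=> m; rewrite mulr_gt0// powR_gt0//; near: m; exact: nbhs_right_gt.
have -> : unstable.inv_fun (fun m : R => c * m `^ (- p)) = (fun m => c^-1 * m `^ p).
  by apply/funext => m; rewrite /= invfM powRN invrK.
exact: cvg_scaled_powR0.
Unshelve. all: by end_near. Qed.

Lemma eqTheta_scaled (f g : R -> R) c : 0 < c ->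
  (forall m, 0 < m -> f m = c * g m) -> f =Theta_((0 : R)^'+) g.
Proof.
move=> c0 fg; rewrite eqThetaE qualifE; apply/asboolP.
exists (c, c) => /=; first by rewrite c0.
near=> m; have m0 : 0 < m by near: m; exact: nbhs_right_gt.
by rewrite fg// normrM (gtr0_norm c0).
Unshelve. all: by end_near. Qed.

Lemma cvg_at_right_eq (T : topologicalType) (f g : R -> T) (l : set_system T) :
  (forall m, 0 < m -> g m = f m) ->
  f m @[m --> (0 : R)^'+] --> l -> g m @[m --> (0 : R)^'+] --> l.
Proof.
move=> fg; apply: cvg_trans; apply: near_eq_cvg; near=> m.
by apply/esym/fg; near: m; exact: nbhs_right_gt.
Unshelve. all: by end_near. Qed.

End limits.

(** * The family of rescaled minimizers *)

Section minimizers.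
Context {R : realType} (K gamma : R) (K_gt0 : 0 < K) (gamma_gt : 4 / 3 < gamma).
Implicit Types (m : R) (f rho sigma : R3 R -> R).
Local Notation A := (scaleA gamma).
Local Notation B := (scaleB gamma).
Local Notation q := (3 * gamma - 4).

Lemma the_minimizer_ge0 m rho : is_the_minimizer K gamma m rho -> forall x, 0 <= rho x.
Proof. by move=> [[/densitiesP[]]]. Qed.

Lemma the_minimizer_max m rho : is_the_minimizer K gamma m rho ->
  forall x, rho x <= rho 0.
Proof.
by move=> h x; apply: (the_minimizer_decr h); rewrite enorm0 enorm_ge0.
Qed.

Lemma the_minimizer_Linfty m rho : is_the_minimizer K gamma m rho ->
  Linfty_norm rho = (rho 0)%:E.
Proof.
move=> h; apply: Linfty_norm_max; first exact: the_minimizer_cont h.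
- exact: the_minimizer_ge0 h.
- exact: the_minimizer_max h.
Qed.

Lemma the_minimizer_spt m rho : is_the_minimizer K gamma m rho ->
  spt rho = closure [set x | 0 < rho x].
Proof.
move=> h; have /densitiesP[mf f0 _ fm] := (the_minimizer_min h).1.
by apply: sptE => //; [exact: the_minimizer_cont h|rewrite fm ltry].
Qed.

(** By uniqueness and continuity one minimizer is a translate of the other, and
both values at [0] are the maximum. *)
Lemma the_minimizer_center m rho1 rho2 : is_the_minimizer K gamma m rho1 ->
  is_the_minimizer K gamma m rho2 -> rho1 0 = rho2 0.
Proof.
move=> h1 h2; have [a ae12] := the_minimizer_uniq h1 (the_minimizer_min h2).
have c1 := the_minimizer_cont h1; have c2 := the_minimizer_cont h2.
have c1a : continuous (fun x : R3 R => rho1 (x - a)).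
  have ca : continuous (fun x : R3 R => (x - a : R3 R)).
    by move=> x; apply: (@cvgB R (R * R * R)%type); [exact: cvg_id|exact: cvg_cst].
  by move=> x; apply: (continuous_comp (ca x)); exact: c1.
have E := ae_eq_continuous c2 c1a ae12.
apply/eqP; rewrite eq_le; apply/andP; split.
  by have := E a; rewrite subrr => <-; exact: the_minimizer_max h2 _.
by rewrite E; exact: the_minimizer_max h1 _.
Qed.

Lemma closure_dilation (P : set (R3 R)) (b : R) : 0 < b ->
  closure [set x | P (b *: x)] = [set x | closure P (b *: x)].
Proof.
move=> b0; apply/seteqP; split => x /= clx V Vx.
  have : nbhs x [set y | V (b *: y)] by exact: (@scaler_continuous _ _ b x).
  by move=> /clx[y [/= Py Vy]]; exists (b *: y).
have : nbhs (b *: x) [set y | V (b^-1 *: y)].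
  apply: (@scaler_continuous _ _ b^-1 (b *: x)).
  by rewrite scalerA mulVf ?gt_eqF// scale1r.
move=> /clx[y [/= Py Vy]]; exists (b^-1 *: y); split => //=.
by rewrite scalerA mulfV ?gt_eqF// scale1r.
Qed.

Section family.
Variables (sigma : R3 R -> R) (sigma_min : is_the_minimizer K gamma 1 sigma).
Local Notation sigma_ := (rescaled gamma sigma).

Lemma rescaled_the_minimizer m : 0 < m -> is_the_minimizer K gamma m (sigma_ m).
Proof. by move=> m0; rewrite -{1}(mulr1 m); exact: is_the_minimizer_rescaled. Qed.

Lemma rescaled_center m : 0 < m -> sigma_ m 0 = sigma 0 * m `^ (2 / q).
Proof. by move=> m0; rewrite /rescaled scaler0 mulrC -powRN opprK. Qed.

Lemma spt_rescaled m : 0 < m ->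
  spt (sigma_ m) = [set x | spt sigma ((B m)^-1 *: x)].
Proof.
move=> m0; have iB0 : 0 < (B m)^-1 by rewrite invr_gt0 scaleB_gt0.
rewrite (the_minimizer_spt (rescaled_the_minimizer m0)) (the_minimizer_spt sigma_min).
rewrite -(closure_dilation _ iB0); congr closure; apply/seteqP; split => x /=.
  by rewrite /rescaled pmulr_rgt0// invr_gt0 scaleA_gt0.
by rewrite /rescaled pmulr_rgt0// invr_gt0 scaleA_gt0.
Qed.

Lemma eball_dilation (b r : R) (c x : R3 R) : 0 < b ->
  eball (b *: c) (b * r) x <-> eball c r (b^-1 *: x).
Proof.
move=> b0; rewrite /eball /=.
have -> : x - b *: c = b *: (b^-1 *: x - c).
  by rewrite scalerBr scalerA mulfV ?gt_eqF// scale1r.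
by rewrite enormZ ?ltW// ltr_pM2l.
Qed.

Lemma ball_spt_rescaled m r : 0 < m ->
  in_ball_of_radius (spt (sigma_ m)) (B m * r) <-> in_ball_of_radius (spt sigma) r.
Proof.
move=> m0; have B0 := scaleB_gt0 gamma m0; have BN : B m != 0 by rewrite gt_eqF.
rewrite spt_rescaled//; split => -[c sc].
  exists ((B m)^-1 *: c) => x sx.
  have := sc (B m *: x); rewrite /= scalerA mulVf// scale1r => /(_ sx).
  rewrite -{1}(scale1r c) -(mulfV BN) -scalerA => /(eball_dilation _ _ _ B0).
  by rewrite scalerA mulVf// scale1r.
by exists (B m *: c) => x /= /sc xc; apply/eball_dilation.
Qed.

Lemma set_size_rescaled m : 0 < m ->
  set_size (spt (sigma_ m)) = ((B m)%:E * set_size (spt sigma))%E.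
Proof.
move=> m0; have B0 := scaleB_gt0 gamma m0; have BN : B m != 0 by rewrite gt_eqF.
rewrite /set_size -ereal_inf_pZl//; congr ereal_inf; apply/seteqP; split => x /=.
  move=> [r [r0 sr] <-]; exists ((B m)^-1 * r)%:E.
    exists ((B m)^-1 * r) => //; split; first by rewrite mulr_ge0// invr_ge0 ltW.
    by apply/(ball_spt_rescaled _ m0); rewrite mulrA mulfV// mul1r.
  by rewrite -EFinM mulrA mulfV// mul1r.
move=> [_ [r [r0 sr] <-] <-]; exists (B m * r); last by rewrite EFinM.
by split; [rewrite mulr_ge0// ltW|apply/ball_spt_rescaled].
Qed.

Lemma spt_in_ball : exists2 r : R, 0 < r & in_ball_of_radius (spt sigma) r.
Proof.
have [r r0 sr] := compact_support K_gt0 gamma_gt sigma_min.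
exists (r + 1); first by rewrite addr_gt0.
by exists 0 => x /sr /= xr; rewrite /eball /= subr0 (le_lt_trans xr)// ltrDl.
Qed.

(** The size is positive because the support contains a neighbourhood of [0]: two
points at distance [d] lie in no ball of radius at most [d/2]. *)
Lemma set_size_spt : exists2 s : R, 0 < s & set_size (spt sigma) = s%:E.
Proof.
have s00 := center_gt0 sigma_min.
have [d d0 dP] := nbhs_cube (near_gt (the_minimizer_cont sigma_min) s00).
have lb : ((d / 2)%:E <= set_size (spt sigma))%E.
  apply/ereal_infP => _ [r [r0 [c sc]] <-]; rewrite lee_fin.
  have inS (t : R) : `|t| < d -> eball c r (t, 0, 0).
    move=> td; apply: sc; rewrite (the_minimizer_spt sigma_min).
    apply: subset_closure; apply: dP; apply/cubeP.
    by rewrite /= !subr0 normr0; split.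
  have h1 : `|d / 2| < d by rewrite gtr0_norm; lra.
  have h2 : `|- (d / 2)| < d by rewrite normrN.
  have [e1 _ _] := coord_le_enorm ((d / 2, 0, 0) - c : R3 R).
  have [e2 _ _] := coord_le_enorm ((- (d / 2), 0, 0) - c : R3 R).
  have := le_lt_trans e1 (inS _ h1); have := le_lt_trans e2 (inS _ h2).
  by rewrite /= !ltr_norml => /andP[? ?] /andP[? ?]; lra.
have [r r0 sr] := spt_in_ball.
have ub : (set_size (spt sigma) <= r%:E)%E.
  by apply: ereal_inf_lbound; exists r => //; split => //; exact: ltW.
move: lb ub; case: (set_size _) => [s| |]//; rewrite !lee_fin => lb _.
by exists s => //; apply: lt_le_trans lb; rewrite divr_gt0.
Qed.

End family.
End minimizers.

Theorem mainTheorem5 (R : realType) (K gamma : R) (sigma : R3 R -> R)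
  (K_gt0 : 0 < K) (gamma_gt : 4 / 3 < gamma)
  (sigma_min : is_the_minimizer K gamma 1 sigma) :
  let A := scaleA gamma in
  let B := scaleB gamma in
  let sigma_ := rescaled gamma sigma in
  (* sigma_m is the minimizer with mass m *)
  (forall m, 0 < m -> is_the_minimizer K gamma m (sigma_ m)) /\
  (* the constants C_1 and R_1 exist *)
  (exists C1 R1 : R, (Linfty_norm sigma <= C1%:E)%E /\
     in_ball_of_radius (spt sigma) R1) /\
  (* any such constants give the bounds C_m = C_1 / A and R_m = B R_1 *)
  (forall C1 R1 : R, (Linfty_norm sigma <= C1%:E)%E ->
     in_ball_of_radius (spt sigma) R1 ->
     forall m, 0 < m ->
       (Linfty_norm (sigma_ m) <= (C1 / A m)%:E)%E /\
       in_ball_of_radius (spt (sigma_ m)) (B m * R1)) /\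
  (* gamma > 2 : limits and rates *)
  (2 < gamma ->
     [/\ A m @[m --> 0^'+] --> +oo,
         B m @[m --> 0^'+] --> 0,
         Linfty_norm (sigma_ m) @[m --> 0^'+] --> 0%E,
         set_size (spt (sigma_ m)) @[m --> 0^'+] --> 0%E &
       [/\ (fun m => fine (Linfty_norm (sigma_ m)))
             =Theta_(0^'+) (fun m => m `^ (2 / (3 * gamma - 4))),
           (fun m => fine (set_size (spt (sigma_ m))))
             =Theta_(0^'+) (fun m => m `^ ((gamma - 2) / (3 * gamma - 4))) &
           (fun m => sigma_ m 0)
             =Theta_(0^'+) (fun m => m `^ (2 / (3 * gamma - 4)))]]) /\
  (* the sup norm is the central density *)
  (forall m, 0 < m -> Linfty_norm (sigma_ m) = (sigma_ m 0)%:E) /\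
  (* the mass is a strictly increasing function of the central density *)
  (exists M : R -> R,
     (forall c1 c2, 0 < c1 -> c1 < c2 -> M c1 < M c2) /\
     (forall m rho, 0 < m -> is_the_minimizer K gamma m rho ->
        0 < rho 0 /\ M (rho 0) = m)) /\
  (* gamma < 2 : the density flattens out and spreads *)
  (gamma < 2 ->
     [/\ B m @[m --> 0^'+] --> +oo,
         set_size (spt (sigma_ m)) @[m --> 0^'+] --> +oo%E &
         Linfty_norm (sigma_ m) @[m --> 0^'+] --> 0%E]).
Proof.
have q_gt0 : 0 < 3 * gamma - 4 by move: gamma_gt; rewrite ltr_pdivrMr//; lra.
move=> A B sigma_.
have s0 := center_gt0 sigma_min.
have [s s_gt0 sizeE] := set_size_spt K_gt0 gamma_gt sigma_min.
have mini m : 0 < m -> is_the_minimizer K gamma m (sigma_ m).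
  exact: rescaled_the_minimizer.
have normE m : 0 < m -> Linfty_norm (sigma_ m) = (sigma_ m 0)%:E.
  by move=> /mini; exact: the_minimizer_Linfty.
have centerE m : 0 < m -> sigma_ m 0 = sigma 0 * m `^ (2 / (3 * gamma - 4)).
  exact: rescaled_center.
have sizeE_ m : 0 < m -> set_size (spt (sigma_ m)) = (s * B m)%:E.
  by move=> m0; rewrite (set_size_rescaled K_gt0 gamma_gt sigma_min m0) sizeE -EFinM mulrC.
have p_gt0 : 0 < 2 / (3 * gamma - 4) by rewrite divr_gt0.
have norm_cvg0 : Linfty_norm (sigma_ m) @[m --> 0^'+] --> 0%E.
  apply: (@cvg_at_right_eq _ _
      (fun m => (sigma 0 * m `^ (2 / (3 * gamma - 4)))%:E)).
    by move=> m m0; rewrite normE// centerE.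
  by apply: cvg_EFin; [exact: nearW|exact: cvg_scaled_powR0].
split; first exact: mini.
split.
  have [r _ sr] := spt_in_ball K_gt0 gamma_gt sigma_min.
  by exists (sigma 0), r; split => //; rewrite (the_minimizer_Linfty sigma_min).
split.
  move=> C1 R1; rewrite (the_minimizer_Linfty sigma_min) lee_fin => C1s R1s m m0.
  split; last exact: (ball_spt_rescaled K_gt0 gamma_gt sigma_min R1 m0).2.
  rewrite normE// lee_fin /sigma_ /rescaled scaler0 mulrC ler_pM2r//.
  by rewrite invr_gt0 scaleA_gt0.
split.
  move=> gamma2; have r_gt0 : 0 < (gamma - 2) / (3 * gamma - 4).
    by rewrite divr_gt0// subr_gt0.
  split => //.
  - rewrite /A /scaleA; under eq_fun do rewrite -[_ `^ _]mul1r.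
    exact: cvg_scaled_powRy.
  - exact: powR_cvg0.
  - apply: (@cvg_at_right_eq _ _ (fun m => (s * B m)%:E)) => //.
    by apply: cvg_EFin; [exact: nearW|exact: cvg_scaled_powR0].
  - split.
    + by apply: (eqTheta_scaled s0) => m m0; rewrite normE//= centerE.
    + by apply: (eqTheta_scaled s_gt0) => m m0; rewrite sizeE_.
    + by apply: (eqTheta_scaled s0) => m m0; rewrite centerE.
split; first exact: normE.
split.
  exists (fun c => (c / sigma 0) `^ ((3 * gamma - 4) / 2)); split.
    move=> c1 c2 c10 c12; have c20 := lt_trans c10 c12.
    apply: gt0_ltr_powR; rewrite ?nnegrE ?divr_ge0 ?(ltW c10) ?(ltW c20) ?(ltW s0)//.
      by rewrite divr_gt0.
    by rewrite ltr_pM2r// invr_gt0.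
  move=> m rho m0 rho_min.
  rewrite (the_minimizer_center rho_min (mini m m0)) centerE//; split.
    by rewrite mulr_gt0// powR_gt0.
  rewrite mulrAC mulfV ?gt_eqF// mul1r -powRrM.
  have -> : 2 / (3 * gamma - 4) * ((3 * gamma - 4) / 2) = 1.
    by field; rewrite gt_eqF.
  by rewrite powRr1// ltW.
move=> gamma2; have r_gt0 : 0 < - ((gamma - 2) / (3 * gamma - 4)).
  by rewrite -mulNr divr_gt0// opprB subr_gt0.
have By c : 0 < c -> c * B m @[m --> 0^'+] --> +oo.
  by move=> c0; rewrite /B /scaleB -[(gamma - 2) / _]opprK; exact: cvg_scaled_powRy.
split => //.
- by have := By 1 ltr01; under eq_fun do rewrite mul1r.
- apply: (@cvg_at_right_eq _ _ (fun m => (s * B m)%:E)) => //.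
  by apply/cvgeryP; exact: By.
Qed.
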